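(* For every $n\ge1$, the fibers of the map $\rho:S_n\to\mathrm{dRec}_n$ are exactly the congruence classes of the congruence $\Theta_{\mathrm{tB}}$ on the weak order on $S_n$.
   Context: Permutations are written in one-line notation $x=x_1\cdots x_n\in S_n$. The (right) weak order on $S_n$ is the partial order in which one moves up by a cover by swapping two adjacent entries $x_i<x_{i+1}$ of $x$ (so that they occur out of numerical order); it is a lattice. The congruence $\Theta_{\mathrm{tB}}$. A permutation $x$ is obtained from $y$ by a $(3412\to3142)$-move if $y$ has a subsequence $c\,d\,a\,b$ with $a<b<c<d$ and $d$ immediately before $a$ in $y$, and $x$ is $y$ with $d$ and $a$ swapped. It is obtained from $y$ by a $(2413\to2143)$-move if $y$ has a subsequence $b\,d\,a\,c$ with $a<b<c<d$ and $d$ immediately before $a$ in $y$, and $x$ is $y$ with $d$ and $a$ swapped. $\Theta_{\mathrm{tB}}$ is the lattice congruence on the weak order on $S_n$ such that, for a cover $x\lessdot y$, one has $x\equiv y$ if and only if $x$ is obtained from $y$ by one of these two kinds of move. Its classes are intervals, so $\Theta_{\mathrm{tB}}$ is the equivalence relation generated by these moves (that this is a lattice congruence is a known result). Diagonal rectangulations. Let $S$ be a square with sides parallel to the coordinate axes; its diagonal is the interior of the segment from its top-left corner to its bottom-right corner. For a subdivision of $S$ into finitely many (axis-parallel) rectangles, the walls are the maximal line segments contained in the union of the boundaries of the rectangles, excluding the four edges of $S$. For a set $X$ of $n-1$ distinct points on the diagonal, a diagonal rectangulation of $(S,X)$ is a subdivision of $S$ into rectangles such that no two walls intersect in their interiors,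 every wall contains a point of $X$, and every point of $X$ lies on exactly one wall. Diagonal rectangulations are considered up to dilation or translation of $S$ and order-preserving motion of the points of $X$ along the diagonal (carrying the walls along); an equivalence class is a diagonal rectangulation of size $n$, and it has a unique integral representative, with $S=[0,n]\times[0,n]$ and $X=\{(i,n-i):1\le i\le n-1\}$. $\mathrm{dRec}_n$ is the set of diagonal rectangulations of size $n$, identified with their integral representatives. The map $\rho:S_n\to\mathrm{dRec}_n$. Let $S=[0,n]\times[0,n]$, $p_i=(i,n-i)$ for $0\le i\le n$, and give the space between $p_{k-1}$ and $p_k$ the label $k$. Read $x_1\cdots x_n$ from left to right, drawing one rectangle for each entry. Let $T_{i-1}$ be the union of the left and bottom edges of $S$ and the rectangles drawn in the first $i-1$ steps. In step $i$, put $k=x_i$, $p=p_{k-1}$, $p'=p_k$, and draw the rectangle with the following top-left and bottom-right corners. If $p\notin T_{i-1}$, the top-left corner is the rightmost point of $T_{i-1}$ directly left of $p$; if $p\in T_{i-1}$, it is the highest point of $T_{i-1}$ directly above (or equal to) $p$. If $p'\notin T_{i-1}$, the bottom-right corner is the highest point of $T_{i-1}$ directly below $p'$; if $p'\in T_{i-1}$, it is the rightmost point of $T_{i-1}$ directly right of (or equal to) $p'$. The $n$ rectangles drawn form the diagonal rectangulation $\rho(x)$. *)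

(* Defs.v *)
From HB Require Import structures.
From mathcomp Require Import all_boot all_order all_fingroup all_algebra.
From mathcomp Require Import all_classical all_reals.

Set Implicit Arguments.
Unset Strict Implicit.
Unset Printing Implicit Defensive.

Import Order.TTheory GRing.Theory Num.Theory.

Local Open Scope classical_set_scope.
Local Open Scope ring_scope.

Section WeakOrder.
Variable n : nat.
Implicit Types x y z : 'S_n.

(* A permutation x : 'S_n has one-line notation x 0, x 1, ..., x n.-1: positions
   and values both range over 'I_n = {0, ..., n-1} instead of {1, ..., n}.
   Since (s * t) i = t (s i) in 'S_n, the word of tperm i j * x is the word of x
   with the entries in positions i and j exchanged. *)

Definition weak_cover : rel 'S_n := fun x y =>
  [exists i : 'I_n, [exists j : 'I_n,
    [&& j == i.+1 :> nat, (x i < x j)%N & y == (tperm i j * x)%g]]].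

Definition weak_le : rel 'S_n := connect weak_cover.

Definition is_join x y z : Prop :=
  [/\ weak_le x z, weak_le y z
    & forall w, weak_le x w -> weak_le y w -> weak_le z w].

Definition is_meet x y z : Prop :=
  [/\ weak_le z x, weak_le z y
    & forall w, weak_le w x -> weak_le w y -> weak_le w z].

Definition lattice_congruence (Theta : rel 'S_n) : Prop :=
  [/\ equivalence_rel Theta,
      forall x1 x2 y1 y2 z1 z2, Theta x1 x2 -> Theta y1 y2 ->
        is_join x1 y1 z1 -> is_join x2 y2 z2 -> Theta z1 z2
    & forall x1 x2 y1 y2 z1 z2, Theta x1 x2 -> Theta y1 y2 ->
        is_meet x1 y1 z1 -> is_meet x2 y2 z2 -> Theta z1 z2].

(* x is obtained from y by a (3412 -> 3142)-move: y has a subsequence c d a b,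
   in positions k < i < i+1 = j < l, and x is y with d and a exchanged. *)
Definition move3412 : rel 'S_n := fun x y =>
  [exists k : 'I_n, [exists i : 'I_n, [exists j : 'I_n, [exists l : 'I_n,
    [&& (k < i)%N, j == i.+1 :> nat, (j < l)%N,
        (y j < y l)%N, (y l < y k)%N, (y k < y i)%N
      & x == (tperm i j * y)%g]]]]].

(* Same with a subsequence b d a c, and a (2413 -> 2143)-move. *)
Definition move2413 : rel 'S_n := fun x y =>
  [exists k : 'I_n, [exists i : 'I_n, [exists j : 'I_n, [exists l : 'I_n,
    [&& (k < i)%N, j == i.+1 :> nat, (j < l)%N,
        (y j < y k)%N, (y k < y l)%N, (y l < y i)%N
      & x == (tperm i j * y)%g]]]]].

Definition tB_move : rel 'S_n := fun x y => move3412 x y || move2413 x y.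

Definition tB_congruence (Theta : rel 'S_n) : Prop :=
  lattice_congruence Theta /\
  forall x y, weak_cover x y -> Theta x y = tB_move x y.

(* The unique relation satisfying tB_congruence, as the equivalence relation
   generated by the moves. *)
Definition theta_tB : rel 'S_n :=
  connect (fun x y => tB_move x y || tB_move y x).

Definition is_class (Theta : rel 'S_n) (C : set 'S_n) : Prop :=
  exists x, C = [set y | Theta x y].

End WeakOrder.

Section Rectangulations.
Variable R : realType.

Local Notation plane := (R * R)%type.

(* (u, v) stands for the closed axis-parallel rectangle with top-left corner u
   and bottom-right corner v; it degenerates to a segment when u and v lie on a
   common horizontal or vertical line. *)
Local Notation rect := (plane * plane)%type.

Implicit Types (r W : rect) (F : set rect).

Definition region r : set plane :=
  [set q | r.1.1 <= q.1 <= r.2.1 /\ r.2.2 <= q.2 <= r.1.2].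

Definition interior_region r : set plane :=
  [set q | r.1.1 < q.1 < r.2.1 /\ r.2.2 < q.2 < r.1.2].

Definition boundary r : set plane := region r `\` interior_region r.

Definition is_rectangle r : Prop := r.1.1 < r.2.1 /\ r.2.2 < r.1.2.

Definition is_segment W : Prop :=
  (W.1.1 = W.2.1 /\ W.2.2 < W.1.2) \/ (W.1.2 = W.2.2 /\ W.1.1 < W.2.1).

Definition segment_interior W : set plane := region W `\` [set W.1; W.2].

(* p_i = (i, n - i) *)
Definition pt (n i : nat) : plane := (i%:R, n%:R - i%:R).

Definition square (n : nat) : rect := ((0, n%:R), (n%:R, 0)).
Definition left_edge (n : nat) : rect := ((0, n%:R), (0, 0)).
Definition bottom_edge (n : nat) : rect := ((0, 0), (n%:R, 0)).
Definition right_edge (n : nat) : rect := ((n%:R, n%:R), (n%:R, 0)).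
Definition top_edge (n : nat) : rect := ((0, n%:R), (n%:R, n%:R)).

Definition is_subdivision (n : nat) F : Prop :=
  [/\ finite_set F,
      forall r, F r -> is_rectangle r,
      \bigcup_(r in F) region r = region (square n)
    & forall r r', F r -> F r' -> r <> r' ->
        interior_region r `&` interior_region r' = set0].

Definition boundary_segment F W : Prop :=
  is_segment W /\ region W `<=` \bigcup_(r in F) boundary r.

Definition wall (n : nat) F W : Prop :=
  [/\ boundary_segment F W,
      forall W', boundary_segment F W' -> region W `<=` region W' -> W' = W
    & [/\ W <> left_edge n, W <> bottom_edge n,
          W <> right_edge n & W <> top_edge n]].

(* Integral representatives of the diagonal rectangulations of size n: the set X
   of points of the diagonal is {p_i : 1 <= i <= n - 1}. *)
Definition dRec (n : nat) : set (set rect) := [set F |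
  [/\ is_subdivision n F,
      forall W W', wall n F W -> wall n F W' -> W <> W' ->
        segment_interior W `&` segment_interior W' = set0,
      forall W, wall n F W -> exists2 i, (0 < i < n)%N & region W (pt n i)
    & forall i, (0 < i < n)%N -> exists! W, wall n F W /\ region W (pt n i)]].

Definition drawn (n : nat) (rs : seq rect) : set plane :=
  region (left_edge n) `|` region (bottom_edge n) `|`
  [set q | exists2 r, r \in rs & region r q].

(* Applied below only to nonempty compact sets contained in a horizontal
   (resp. vertical) line, for which the point exists and is unique. *)
Definition rightmost (A : set plane) : plane :=
  xget (0, 0) [set q : plane | A q /\ forall q', A q' -> q'.1 <= q.1].

Definition highest (A : set plane) : plane :=
  xget (0, 0) [set q : plane | A q /\ forall q', A q' -> q'.2 <= q.2].

(* The rectangle drawn when the entry k (1 <= k <= n) is read. *)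
Definition next_rect (n : nat) (rs : seq rect) (k : nat) : rect :=
  let T := drawn n rs in
  let p := pt n k.-1 in
  let p' := pt n k in
  (if p \in T
   then highest [set q | [/\ T q, q.1 = p.1 & p.2 <= q.2]]
   else rightmost [set q | [/\ T q, q.2 = p.2 & q.1 < p.1]],
   if p' \in T
   then rightmost [set q | [/\ T q, q.2 = p'.2 & p'.1 <= q.1]]
   else highest [set q | [/\ T q, q.1 = p'.1 & q.2 < p'.2]]).

Definition one_line (n : nat) (x : 'S_n) : seq nat :=
  [seq (x i : nat).+1 | i <- enum 'I_n].

Definition rho (n : nat) (x : 'S_n) : set rect :=
  [set` foldl (fun rs k => rcons rs (next_rect n rs k)) [::] (one_line x)].

(* The (nonempty) fibers of rho as a map from 'S_n to dRec n. *)
Definition is_rho_fiber (n : nat) (C : set 'S_n) : Prop :=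
  exists F, [/\ dRec n F, C = [set x | rho x = F] & C !=set0].

End Rectangulations.

(* Main.v *)
Require Import Defs.
From mathcomp Require Import all_boot all_order all_fingroup all_algebra.
From mathcomp Require Import all_classical all_reals.
From mathcomp Require Import zify lra.

Set Implicit Arguments.
Unset Strict Implicit.
Unset Printing Implicit Defensive.

Import Order.TTheory GRing.Theory Num.Theory.

(* Write D for the set of labels read before k. The union drawn so far depends
   only on D, and the rectangle drawn at k is cut out by the four labels nearest
   to k: on each side of k, the nearest one in D and the nearest one outside D.
   So rho(x) amounts to knowing, for every k, the nearest smaller and larger
   labels that come before and after k in x. Exchanging adjacent entries a < d
   keeps these data if and only if labels strictly between a and d occur on both
   sides of the exchanged pair, that is, exactly for the moves generating
   Theta_tB; and if x and y have the same data, then any adjacent pair of x that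
   y orders differently can be so exchanged, bringing x closer to y.

   In rho(x) the point p_i lies on a single wall, vertical when i comes before
   i+1 and horizontal otherwise; reversing x reflects the picture in the
   diagonal and exchanges the two cases. *)

(** * Rectangles as nearest labels *)

Section NearestLabels.
Local Open Scope nat_scope.
Implicit Types (P Q : pred nat) (a c k n : nat).

(** The point [pt n i] separates the labels [i] and [i.+1], and every side of a rectangle lies on an
    edge of the square or on the wall through such a point. A nearest smaller label is therefore
    recorded as itself and a nearest larger one as its predecessor; when there is none, the values 0
    and [n] stand for the edges.

    Disjoint interiors and non-crossing walls reduce to contradictions in the reading order.
    Covering the square does not: it comes from the drawing, since the union drawn after all labels
    is the whole square. The obstacle in [dRec] is that walls are maximal segments in a union of
    boundaries in the real plane, with no link to labels. Integrality of the corners resolves it: at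
    a non-integral height only vertical sides occur, and at a non-integral abscissa only horizontal
    ones.

    An abstract congruence is prescribed on covers only. Recovering it from the moves takes joins in
    the weak order, which is why inversion sets appear. *)

Definition pred_nearest P k := \max_(b < k | P b) (b : nat).

(** [find] returns the length of the list when it fails, so the value is [n] if no larger label
    satisfies [P]. *)
Definition before_next n P k := k + find P (iota k.+1 (n - k)).

Lemma pred_nearestP P k : 0 < k ->
  [/\ pred_nearest P k < k, 0 < pred_nearest P k -> P (pred_nearest P k)
    & forall c, pred_nearest P k < c < k -> ~~ P c].
Proof.
move=> k_gt0; split.
- by rewrite -[ltnRHS]prednK // ltnS; apply/bigmax_leqP => -[b] /= ? _; lia.
- rewrite /pred_nearest; elim/big_ind: _ => // a b Pa Pb.
  by rewrite /maxn; case: ifP.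
- move=> c /andP[lt_c c_lt]; apply/negP => Pc.
  have := @leq_bigmax_cond _ (fun b : ordinal k => P b) (@nat_of_ord k) (Ordinal c_lt) Pc.
  by rewrite /= leqNgt lt_c.
Qed.

Lemma before_nextP n P k : k <= n ->
  [/\ k <= before_next n P k <= n,
      before_next n P k < n -> P (before_next n P k).+1
    & forall c, k < c <= before_next n P k -> ~~ P c].
Proof.
move=> k_le; rewrite /before_next; set s := iota _ _.
have sz : size s = n - k by rewrite size_iota.
have find_le : find P s <= n - k by rewrite -sz find_size.
split; first lia.
- move=> lt_n; have lt_find : find P s < n - k by lia.
  have hasP : has P s by rewrite has_find sz.
  by have := nth_find 0 hasP; rewrite nth_iota // addSn.
- move=> c c_in; have lt_c : c - k.+1 < find P s by lia.
  have := before_find 0 lt_c; rewrite nth_iota; last lia.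
  by rewrite subnKC => [->|]; last lia.
Qed.

Lemma pred_nearest_unique P k a : a < k -> (0 < a -> P a) ->
  (forall c, a < c < k -> ~~ P c) -> pred_nearest P k = a.
Proof.
move=> lt_a Pa nP; have k_gt0 : 0 < k by lia.
have [lt_b Pb nPb] := pred_nearestP P k_gt0; set b := pred_nearest P k in lt_b Pb nPb *.
case: (ltngtP a b) => // [lt_ab|lt_ba].
- by have /negP[] := nP b ltac:(lia); apply: Pb; lia.
- by have /negP[] := nPb a ltac:(lia); apply: Pa; lia.
Qed.

Lemma before_next_unique n P k a : k <= a <= n -> (a < n -> P a.+1) ->
  (forall c, k < c <= a -> ~~ P c) -> before_next n P k = a.
Proof.
move=> le_a Pa nP; have k_le : k <= n by lia.
have [le_b Pb nPb] := before_nextP P k_le.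
set b := before_next n P k in le_b Pb nPb *.
case: (ltngtP a b) => // [lt_ab|lt_ba].
- by have /negP[] := nPb a.+1 ltac:(lia); apply: Pa; lia.
- by have /negP[] := nP b.+1 ltac:(lia); apply: Pb; lia.
Qed.

Lemma eq_pred_nearest P Q k : 0 < k -> (forall c, 0 < c < k -> P c = Q c) ->
  pred_nearest P k = pred_nearest Q k.
Proof.
move=> k_gt0 eqPQ; have [lt_b Pb nPb] := pred_nearestP Q k_gt0.
apply: pred_nearest_unique => // [b_gt0|c c_in].
  by rewrite eqPQ ?Pb //; lia.
by rewrite eqPQ ?nPb //; lia.
Qed.

Lemma eq_before_next n P Q k : k <= n -> (forall c, k < c <= n -> P c = Q c) ->
  before_next n P k = before_next n Q k.
Proof.
move=> k_le eqPQ; have [le_b Pb nPb] := before_nextP Q k_le.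
apply: before_next_unique => // [b_lt|c c_in].
  by rewrite eqPQ ?Pb //; lia.
by rewrite eqPQ ?nPb //; lia.
Qed.

(** A label [z] satisfying both predicates screens off everything below it. In an exchange of [a]
    and [d], a label strictly between them plays this role and hides [a] from [d]. *)
Lemma pred_nearest_eq_above P Q k z : z < k -> P z -> Q z ->
  (forall c, z <= c < k -> P c = Q c) -> pred_nearest P k = pred_nearest Q k.
Proof.
move=> z_lt Pz Qz eqPQ; have [lt_b Pb nPb] := pred_nearestP Q (leq_ltn_trans (leq0n z) z_lt).
set b := pred_nearest Q k in lt_b Pb nPb *.
have z_le : z <= b by rewrite leqNgt; apply: contraTN Qz => lt_bz; apply: nPb; lia.
apply: pred_nearest_unique => // [b_gt0|c c_in].
  by rewrite eqPQ ?Pb //; lia.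
by rewrite eqPQ ?nPb //; lia.
Qed.

Lemma before_next_eq_below n P Q k z : k < z <= n -> P z -> Q z ->
  (forall c, k < c <= z -> P c = Q c) -> before_next n P k = before_next n Q k.
Proof.
move=> z_in Pz Qz eqPQ; have k_le : k <= n by lia.
have [le_b Pb nPb] := before_nextP Q k_le.
set b := before_next n Q k in le_b Pb nPb *.
have b_lt : b < z by rewrite ltnNge; apply: contraTN Qz => le_zb; apply: nPb; lia.
apply: before_next_unique => // [b_lt_n|c c_in].
  by rewrite eqPQ ?Pb //; lia.
by rewrite eqPQ ?nPb //; lia.
Qed.

End NearestLabels.

(** * Corners as functions of the reading order, and the walls that contain the sides *)

Section RectangleCoordinates.
Local Open Scope nat_scope.
Variable n : nat.
Implicit Types (pos : nat -> nat) (i j k : nat).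

(** The picture grows from the bottom-left corner: labels read before [k] bound its rectangle on the
    left and below, labels read after it bound it above and on the right. *)
Definition left_of pos k := pred_nearest (fun c => pos c < pos k) k.
Definition top_of pos k := pred_nearest (fun c => pos k < pos c) k.
Definition bottom_of pos k := before_next n (fun c => pos c < pos k) k.
Definition right_of pos k := before_next n (fun c => pos k < pos c) k.

(** The bound by [n] makes the truncated subtraction in [reverse_pos] strictly order-reversing. It
    covers numbers that are not labels, whose index in a word is its length [n]. *)
Definition label_order pos :=
  (forall c, pos c <= n) /\
  (forall c d, 0 < c <= n -> 0 < d <= n -> pos c = pos d -> c = d).

Definition reverse_pos pos c := n - pos c.

Lemma label_order_reverse pos : label_order pos -> label_order (reverse_pos pos).
Proof.
rewrite /reverse_pos => -[pos_le pos_inj]; split=> [c|c d c_in d_in eq_cd].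
  exact: leq_subr.
by apply: pos_inj => //; have := pos_le c; have := pos_le d; lia.
Qed.

Lemma reverse_pos_lt pos c d : label_order pos ->
  (reverse_pos pos c < reverse_pos pos d) = (pos d < pos c).
Proof.
by rewrite /reverse_pos => -[pos_le _]; have := pos_le c; have := pos_le d; lia.
Qed.

Lemma left_of_reverse pos k : label_order pos -> 0 < k ->
  left_of (reverse_pos pos) k = top_of pos k.
Proof.
by move=> ho k_gt0; apply: eq_pred_nearest => // c _; rewrite reverse_pos_lt.
Qed.

Lemma top_of_reverse pos k : label_order pos -> 0 < k ->
  top_of (reverse_pos pos) k = left_of pos k.
Proof.
by move=> ho k_gt0; apply: eq_pred_nearest => // c _; rewrite reverse_pos_lt.
Qed.

Lemma bottom_of_reverse pos k : label_order pos -> k <= n ->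
  bottom_of (reverse_pos pos) k = right_of pos k.
Proof.
by move=> ho k_le; apply: eq_before_next => // c _; rewrite reverse_pos_lt.
Qed.

Lemma right_of_reverse pos k : label_order pos -> k <= n ->
  right_of (reverse_pos pos) k = bottom_of pos k.
Proof.
by move=> ho k_le; apply: eq_before_next => // c _; rewrite reverse_pos_lt.
Qed.

Definition reverseE := (left_of_reverse, top_of_reverse, bottom_of_reverse,
  right_of_reverse, reverse_pos_lt).

Section Order.
Variable pos : nat -> nat.
Hypothesis ho : label_order pos.

Lemma posNlt c d : 0 < c <= n -> 0 < d <= n -> c != d ->
  ~~ (pos c < pos d) -> pos d < pos c.
Proof.
move=> c_in d_in /eqP ne_cd; case: ho => _ pos_inj.
by have := pos_inj c d c_in d_in; lia.
Qed.

Lemma left_ofP k : 0 < k <= n ->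
  [/\ left_of pos k < k, 0 < left_of pos k -> pos (left_of pos k) < pos k
    & forall c, left_of pos k < c < k -> pos k < pos c].
Proof.
move=> k_in; have [? ? nP] := pred_nearestP (fun c => pos c < pos k) (proj1 (andP k_in)).
by split=> // c c_in; apply: posNlt; rewrite ?nP //; lia.
Qed.

Lemma top_ofP k : 0 < k <= n ->
  [/\ top_of pos k < k, 0 < top_of pos k -> pos k < pos (top_of pos k)
    & forall c, top_of pos k < c < k -> pos c < pos k].
Proof.
move=> k_in; have [? ? nP] := pred_nearestP (fun c => pos k < pos c) (proj1 (andP k_in)).
by split=> // c c_in; apply: posNlt; rewrite ?nP //; lia.
Qed.

Lemma bottom_ofP k : 0 < k <= n ->
  [/\ k <= bottom_of pos k <= n,
      bottom_of pos k < n -> pos (bottom_of pos k).+1 < pos k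
    & forall c, k < c <= bottom_of pos k -> pos k < pos c].
Proof.
move=> k_in; have [le_b ? nP] := before_nextP (fun c => pos c < pos k) (proj2 (andP k_in)).
split=> // c c_in; apply: posNlt; rewrite ?nP //; rewrite /bottom_of in c_in; lia.
Qed.

Lemma right_ofP k : 0 < k <= n ->
  [/\ k <= right_of pos k <= n,
      right_of pos k < n -> pos k < pos (right_of pos k).+1
    & forall c, k < c <= right_of pos k -> pos c < pos k].
Proof.
move=> k_in; have [le_b ? nP] := before_nextP (fun c => pos k < pos c) (proj2 (andP k_in)).
split=> // c c_in; apply: posNlt; rewrite ?nP //; rewrite /right_of in c_in; lia.
Qed.

(** The label [k.-1] is read before or after [k], so it is one of the two nearest smaller labels.
    Hence the top-left corner alone determines [k], which makes [rectangle_inj] possible. *)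
Lemma left_top_max k : 0 < k <= n -> maxn (left_of pos k) (top_of pos k) = k.-1.
Proof.
move=> k_in; have [lt_l _ nl] := left_ofP k_in; have [lt_t _ nt] := top_ofP k_in.
have := nl k.-1; have := nt k.-1; lia.
Qed.

(** Labels from [j] to [right_of n pos j] are read no later than [j], those strictly between
    [left_of pos k] and [k] after [k]; overlapping ranges would contradict [pos j < pos k]. So a
    vertical line separates the two rectangles when the smaller label is read first. *)
Lemma right_of_le_left j k : 0 < j -> j < k -> k <= n -> pos j < pos k ->
  right_of pos j <= left_of pos k.
Proof.
move=> j_gt0 lt_jk k_le lt_pos.
have [lt_l Pl nl] := @left_ofP k ltac:(lia).
have [le_r Pr nr] := @right_ofP j ltac:(lia).
rewrite leqNgt; apply/negP => lt_lr.
case: (ltnP (right_of pos j) k) => [lt_rk|le_kr].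
  case: (eqVneq (right_of pos j) j) => [eq_rj|ne_rj].
    by have := nl (right_of pos j) ltac:(lia); rewrite eq_rj; lia.
  have := nl (right_of pos j) ltac:(lia).
  by have := nr (right_of pos j) ltac:(move/eqP: ne_rj; lia); lia.
by have := nr k ltac:(lia); lia.
Qed.

Lemma left_of_succ i : 0 < i < n -> pos i < pos i.+1 -> left_of pos i.+1 = i.
Proof. by move=> i_in lt_pos; apply: pred_nearest_unique => // c; lia. Qed.

Lemma right_of_prev i : 0 < i < n -> pos i < pos i.+1 -> right_of pos i = i.
Proof. by move=> i_in lt_pos; apply: before_next_unique => // [|c]; lia. Qed.

(* The left side of the rectangle [k] lies on the vertical wall through [p_i]. *)
Lemma left_side_in_wall k (i := left_of pos k) : 0 < k <= n -> 0 < i ->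
  [/\ pos i < pos i.+1, top_of pos i.+1 <= top_of pos k
    & bottom_of pos k <= bottom_of pos i].
Proof.
move=> k_in i_gt0; have [lt_ik lt_pos after_k] := left_ofP k_in.
rewrite -/i in lt_ik lt_pos after_k; move: lt_pos => /(_ i_gt0) lt_pos.
have := left_top_max k_in; rewrite -/i => max_k.
have [i1k|i1k] := eqVneq i.+1 k.
- rewrite i1k; split=> //.
  have [le_b Pb nb] := @bottom_ofP i ltac:(lia).
  have [le_c Pc nc] := bottom_ofP k_in.
  rewrite leqNgt; apply/negP => lt_bc.
  have [eq_bi|ne_bi] := eqVneq (bottom_of pos i) i.
    by have := Pb ltac:(lia); rewrite eq_bi i1k; lia.
  by have := Pb ltac:(lia); have := nc (bottom_of pos i).+1 ltac:(lia); lia.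
- have lt_i1k : i.+1 < k by move/eqP: i1k; lia.
  have := after_k i.+1 ltac:(lia).
  have [lt_t _ _] := @top_ofP i.+1 ltac:(lia).
  have [lt_tk _ _] := @top_ofP k ltac:(lia).
  (* As [i] is less than [k.-1], [max_k] forces [top_of pos k] to be [k.-1]. *)
  split; [lia|lia|].
  have [le_b Pb nb] := @bottom_ofP i ltac:(lia).
  have [le_c Pc nc] := bottom_ofP k_in.
  rewrite leqNgt; apply/negP => lt_bc.
  have := Pb ltac:(lia) => lt_b.
  have [lt_b1|gt_b1|eq_b1] := ltngtP (bottom_of pos i).+1 k.
  + by have := after_k (bottom_of pos i).+1 ltac:(lia); lia.
  + by have := nc (bottom_of pos i).+1 ltac:(lia); lia.
  + by rewrite eq_b1 in lt_b; lia.
Qed.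

(** The labels above [k] up to [i] precede [k], and [i.+1] follows it. A label that stops the wall
    from above follows [i.+1], hence [k], so it is at most [top_of pos k]. Below, if [k < i] then
    [k.+1] precedes [k], and rectangle [k] already ends at the height of [pt n k]. *)
Lemma right_side_in_wall k (i := right_of pos k) : 0 < k <= n -> i < n ->
  [/\ pos i < pos i.+1, top_of pos i.+1 <= top_of pos k
    & bottom_of pos k <= bottom_of pos i].
Proof.
move=> k_in i_lt; have [le_ki lt_pos before_k] := right_ofP k_in.
rewrite -/i in le_ki lt_pos before_k; move: lt_pos => /(_ i_lt) lt_pos.
have lt_posi : pos i < pos i.+1.
  have [eq_ik|ne_ik] := eqVneq i k; first by rewrite {1}eq_ik.
  by have := before_k i ltac:(move/eqP: ne_ik; lia); lia.
split=> //.
- have [lt_t Pt nt] := @top_ofP i.+1 ltac:(lia).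
  have [lt_u Pu nu] := @top_ofP k ltac:(lia).
  rewrite leqNgt; apply/negP => lt_ut.
  have := Pt ltac:(lia) => lt_after.
  have [lt_tk|gt_tk|eq_tk] := ltngtP (top_of pos i.+1) k.
  + by have := nu (top_of pos i.+1) ltac:(lia); lia.
  + by have := before_k (top_of pos i.+1) ltac:(lia); lia.
  + by rewrite eq_tk in lt_after; lia.
- have [eq_ik|ne_ik] := eqVneq i k; first by rewrite eq_ik.
  have lt_ki : k < i by move/eqP: ne_ik; lia.
  have [le_b _ nb] := bottom_ofP k_in.
  have [le_c _ _] := @bottom_ofP i ltac:(lia).
  rewrite leqNgt; apply/negP => lt_bc.
  by have := before_k k.+1 ltac:(lia); have := nb k.+1 ltac:(lia); lia.
Qed.

(** A crossing would order a single pair of labels in both ways: [i] and [j.+1] if [i < j], and [j]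
    and [i.+1] if [j < i]. *)
Lemma walls_do_not_cross i j : 0 < i < n -> 0 < j < n ->
    pos i < pos i.+1 -> pos j.+1 < pos j ->
    top_of pos i.+1 < j < bottom_of pos i -> left_of pos j.+1 < i < right_of pos j ->
  False.
Proof.
move=> i_in j_in vert_i hor_j j_mid i_mid.
have [lt_ij|lt_ji|eq_ij] := ltngtP i j; last by rewrite eq_ij in vert_i; lia.
- have [_ _ nb] := @bottom_ofP i ltac:(lia); have [_ _ nl] := @left_ofP j.+1 ltac:(lia).
  by have := nb j.+1 ltac:(lia); have := nl i ltac:(lia); lia.
- have [_ _ nt] := @top_ofP i.+1 ltac:(lia); have [_ _ nr] := @right_ofP j ltac:(lia).
  by have := nt j ltac:(lia); have := nr i.+1 ltac:(lia); lia.
Qed.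

End Order.

Section ReverseOrder.
Variable pos : nat -> nat.
Hypothesis ho : label_order pos.
Let ho' := label_order_reverse ho.

Lemma bottom_of_le_top j k : 0 < j -> j < k -> k <= n -> pos k < pos j ->
  bottom_of pos j <= top_of pos k.
Proof.
move=> j_gt0 lt_jk k_le lt_pos; have := @right_of_le_left _ ho' j k.
by rewrite !reverseE //; [apply | lia..].
Qed.

Lemma top_of_succ i : 0 < i < n -> pos i.+1 < pos i -> top_of pos i.+1 = i.
Proof.
move=> i_in; rewrite -left_of_reverse // => lt_pos.
by rewrite left_of_succ ?reverse_pos_lt.
Qed.

Lemma bottom_of_prev i : 0 < i < n -> pos i.+1 < pos i -> bottom_of pos i = i.
Proof.
move=> i_in; rewrite -right_of_reverse //; last lia.
by move=> lt_pos; rewrite right_of_prev ?reverse_pos_lt.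
Qed.

Lemma top_side_in_wall k (i := top_of pos k) : 0 < k <= n -> 0 < i ->
  [/\ pos i.+1 < pos i, left_of pos i.+1 <= left_of pos k
    & right_of pos k <= right_of pos i].
Proof.
move=> k_in i_gt0; have [lt_ik _ _] := top_ofP ho k_in; rewrite -/i in lt_ik.
have := @left_side_in_wall _ ho' k k_in.
rewrite left_of_reverse //; last lia.
by rewrite -/i !reverseE //; [apply | lia..].
Qed.

Lemma bottom_side_in_wall k (i := bottom_of pos k) : 0 < k <= n -> i < n ->
  [/\ pos i.+1 < pos i, left_of pos i.+1 <= left_of pos k
    & right_of pos k <= right_of pos i].
Proof.
move=> k_in i_lt; have [le_ki _ _] := bottom_ofP ho k_in; rewrite -/i in le_ki.
have := @right_side_in_wall _ ho' k k_in.
rewrite right_of_reverse //; last lia.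
by rewrite -/i !reverseE //; [apply | lia..].
Qed.

End ReverseOrder.
End RectangleCoordinates.

(** * Drawing the rectangles *)

Ltac nlia := repeat match goal with
  | H : context [@GRing.natmul] |- _ => clear H
  | H : context [@Order.le] |- _ => clear H
  | H : context [@Order.lt] |- _ => clear H
  | H : context [@GRing.zero] |- _ => clear H end; lia.
Ltac rlra := repeat match goal with
  | H : context [leq] |- _ => clear H end; lra.

Section Drawing.
Local Open Scope classical_set_scope.
Local Open Scope ring_scope.
Variables (R : realType) (n : nat).
Local Notation plane := (R * R)%type.
Local Notation rect := (plane * plane)%type.
Implicit Types (D : pred nat) (s : seq nat) (rs : seq rect).

Definition cell D k : rect :=
  (((pred_nearest D k)%:R, n%:R - (pred_nearest (predC D) k)%:R),
   ((before_next n (predC D) k)%:R, n%:R - (before_next n D k)%:R)).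

(* What is drawn depends only on the set [D] of labels read so far: each maximal
   run a+1, ..., m of labels in [D] contributes the rectangle with top-right
   corner (m, n - a), and everything below and to the left of it. *)
Definition staircase D : set plane := [set q |
  [/\ 0 <= q.1 <= n%:R, 0 <= q.2 <= n%:R
    & [\/ q.1 = 0, q.2 = 0 | exists a m, [/\ (a < m <= n)%N,
        (forall c, (a < c <= m)%N -> D c), q.1 <= m%:R & q.2 <= n%:R - a%:R]]]].

Lemma highestE (A : set plane) q :
  A q -> (forall q', A q' -> q'.1 = q.1 /\ q'.2 <= q.2) -> highest A = q.
Proof.
move=> Aq maxq; apply: xget_unique => [|q' [Aq' maxq']].
  by split=> // q' /maxq[].
have [eq1 le2] := maxq _ Aq'; have le2' := maxq' _ Aq.
by move: q q' {maxq maxq' Aq Aq'} eq1 le2 le2' => [? ?] [? ?] /= -> *; congr pair; rlra.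
Qed.

Lemma rightmostE (A : set plane) q :
  A q -> (forall q', A q' -> q'.2 = q.2 /\ q'.1 <= q.1) -> rightmost A = q.
Proof.
move=> Aq maxq; apply: xget_unique => [|q' [Aq' maxq']].
  by split=> // q' /maxq[].
have [eq1 le2] := maxq _ Aq'; have le2' := maxq' _ Aq.
by move: q q' {maxq maxq' Aq Aq'} eq1 le2 le2' => [? ?] [? ?] /= -> *; congr pair; rlra.
Qed.

Lemma natR_le a b : (a <= b)%N -> a%:R <= b%:R :> R.
Proof. by rewrite ler_nat. Qed.

(** No run of labels in [D] passes through [k], so a run starting below [k] also ends below it. If
    [k.-1] is in [D], the maximal run ending there starts after [u] and gives the height above
    [pt n k.-1]. Otherwise the runs at that height end at [l] or earlier, and the run consisting of
    [l] alone reaches it. *)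
Lemma top_left_corner rs D k : drawn n rs = staircase D -> (0 < k <= n)%N -> ~~ D k ->
  (next_rect n rs k).1 = (cell D k).1.
Proof.
move=> /= -> k_in nDk.
have [lt_l Dl nDl] := pred_nearestP D (proj1 (andP k_in)).
have [lt_u Du nDu] := pred_nearestP (predC D) (proj1 (andP k_in)).
rewrite /cell /=; set l := pred_nearest D k in lt_l Dl nDl *.
set u := pred_nearest _ k in lt_u Du nDu *; clearbody l u.
have R0l := natR_le (leq0n l); have R0u := natR_le (leq0n u).
have Rlk : l%:R <= k.-1%:R :> R by apply: natR_le; nlia.
have Ruk : u%:R <= k.-1%:R :> R by apply: natR_le; nlia.
have Rkn : k.-1%:R + 1 <= n%:R :> R.
  by rewrite -[X in _ + X]/(1%:R) -natrD; apply: natR_le; nlia.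
have run_below a m : (a < m)%N -> (forall c, (a < c <= m)%N -> D c) ->
    (a < k)%N -> (m < k)%N.
  move=> lt_am run lt_ak; rewrite ltnNge; apply/negP => le_km.
  by move/negP: nDk; apply; apply: run; nlia.
case: ifPn => [/set_mem|/negP kT].
- move=> [_ _ pT].
  have on_stair : k = 1%N \/ D k.-1.
    case: pT => /= [/eqP|k0|[a [m [am run le_km]]]].
    + by rewrite pnatr_eq0; nlia.
    + by exfalso; rlra.
    + rewrite lerD2l lerN2 ler_nat => le_ak; right.
      move: le_km; rewrite ler_nat => le_km.
      have lt_mk : (m < k)%N by apply: (run_below a) => //; nlia.
      by apply: run; nlia.
  have eq_l : l = k.-1.
    case: on_stair => [|Dk]; first nlia.
    by case: (ltngtP l k.-1) => //; [move=> lt; move: (nDl k.-1); rewrite Dk; nlia | nlia].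
  apply: highestE => [|q' [/= [b1 b2 qT] q'1 q'2]].
    split=> /=; [|by rewrite eq_l|by rlra].
    split=> /=; [rlra|rlra|].
    case: on_stair => [k1|Dk]; first by constructor 1; have -> : l = 0%N by nlia.
    have [k1|k_gt1] := eqVneq k 1%N; first by constructor 1; have -> : l = 0%N by nlia.
    constructor 3; exists u, k.-1; split=> //.
    + case: (ltnP u k.-1) => [|le]; first nlia.
      have eq_uk : u = k.-1 by nlia.
      by have := Du ltac:(nlia); rewrite /= eq_uk Dk.
    + by move=> c c_in; have := nDu c ltac:(nlia); rewrite /= negbK.
  rewrite q'1 eq_l; split=> //.
  case: qT => [q0|q0|[a [m [am run le_qm le_qa]]]].
  + have k1 : k.-1 = 0%N by apply/eqP; rewrite -(pnatr_eq0 R); apply/eqP; rlra.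
    by rewrite (_ : u = 0%N); [rlra | nlia].
  + by rlra.
  + have le_km : (k.-1 <= m)%N by rewrite -(ler_nat R); rlra.
    have le_ak : (a <= k.-1)%N by rewrite -(ler_nat R); rlra.
    have lt_mk : (m < k)%N by apply: (run_below a); [nlia|exact: run|nlia].
    have le_ua : (u <= a)%N.
      rewrite leqNgt; apply/negP => lt_au.
      by have := Du ltac:(nlia); rewrite /= run //; nlia.
    by have := natR_le le_ua; rlra.
- have off_stair : (1 < k)%N /\ ~~ D k.-1.
    case: (ltnP 1 k) => [k_gt1|k_le1]; split=> //.
    + apply/negP => Dk; apply: kT; rewrite inE; split=> /=; [rlra|rlra|].
      (* The run consisting of [k.-1] alone would contain the point. *)
      constructor 3; exists k.-2, k.-1; split=> //; first nlia.
      - by move=> c c_in; have -> : c = k.-1 by nlia.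
      - by rewrite lerD2l lerN2 ler_nat; nlia.
    + by exfalso; apply: kT; rewrite inE; split=> /=; [rlra|rlra|constructor 1];
         have -> : k.-1 = 0%N by nlia.
    + by exfalso; apply: kT; rewrite inE; split=> /=; [rlra|rlra|constructor 1];
         have -> : k.-1 = 0%N by nlia.
  case: off_stair => k_gt1 nDk1.
  have eq_u : u = k.-1.
    by case: (ltngtP u k.-1) => //; [move=> lt; move: (nDu k.-1); rewrite /= nDk1; nlia | nlia].
  have lt_lk1 : (l < k.-1)%N.
    rewrite ltn_neqAle; apply/andP; split; last nlia.
    by apply: contra nDk1 => /eqP eq_lk; rewrite -eq_lk; apply: Dl; nlia.
  apply: rightmostE => [|q' [/= [b1 b2 qT] q'2 q'1]].
    split=> /=; [|by rewrite eq_u|by rewrite ltr_nat].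
    split=> /=; [rlra|rlra|].
    have [->|l_gt0] := posnP l; first by constructor 1.
    constructor 3; exists l.-1, l; split=> //; first nlia.
    + by move=> c c_in; rewrite (_ : c = l); [apply: Dl | nlia]; nlia.
    + by rewrite lerD2l lerN2 ler_nat; nlia.
  rewrite q'2 eq_u; split=> //.
  case: qT => [q0|q0|[a [m [am run le_qm le_qa]]]].
  + by rlra.
  + by rlra.
  + have le_ak : (a <= k.-1)%N by rewrite -(ler_nat R); rlra.
    have lt_mk : (m < k)%N by apply: (run_below a); [nlia|exact: run|nlia].
    have le_ml : (m <= l)%N.
      rewrite leqNgt; apply/negP => lt_lm.
      by have := nDl m ltac:(nlia); rewrite run //; nlia.
    by have := natR_le le_ml; rlra.
Qed.

(** The mirror image of [top_left_corner] in the other diagonal: a run that reaches [k] or beyond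
    starts at [k] or later. *)
Lemma bottom_right_corner rs D k : drawn n rs = staircase D -> (0 < k <= n)%N -> ~~ D k ->
  (next_rect n rs k).2 = (cell D k).2.
Proof.
move=> /= -> k_in nDk.
have [le_w Dw nDw] := before_nextP D (proj2 (andP k_in)).
have [le_r Dr nDr] := before_nextP (predC D) (proj2 (andP k_in)).
rewrite /cell /=; set w := before_next n D k in le_w Dw nDw *.
set r := before_next n _ k in le_r Dr nDr *; clearbody w r.
have R0k := natR_le (leq0n k).
have Rkr : k%:R <= r%:R :> R by apply: natR_le; nlia.
have Rkw : k%:R <= w%:R :> R by apply: natR_le; nlia.
have Rrn : r%:R <= n%:R :> R by apply: natR_le; nlia.
have Rwn : w%:R <= n%:R :> R by apply: natR_le; nlia.
have Rk1 : 1%:R <= k%:R :> R by apply: natR_le; nlia.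
have run_above a m : (a < m)%N -> (forall c, (a < c <= m)%N -> D c) ->
    (k <= m)%N -> (k <= a)%N.
  move=> lt_am run le_km; rewrite leqNgt; apply/negP => lt_ak.
  by move/negP: nDk; apply; apply: run; nlia.
case: ifPn => [/set_mem|/negP kT].
- move=> [_ _ pT].
  have on_stair : k = n \/ ((k < n)%N /\ D k.+1).
    have [->|ne_kn] := eqVneq k n; first by left.
    have lt_kn : (k < n)%N by nlia.
    have := lt_kn; rewrite -(ltr_nat R) => Rkn.
    right; split=> //;
    case: pT => /= [k0|k0|[a [m [am run le_km]]]];
      [by exfalso; rlra|by exfalso; rlra|].
    rewrite lerD2l lerN2 ler_nat => le_ak.
    move: le_km; rewrite ler_nat => le_km.
    by have le_ka : (k <= a)%N; [apply: (run_above a m) => //; nlia | apply: run; nlia].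
  have eq_w : w = k.
    case: on_stair => [|[lt_kn Dk]]; first nlia.
    by case: (ltngtP k w) => //; [move=> lt; move: (nDw k.+1); rewrite Dk; nlia | nlia].
  apply: rightmostE => [|q' [/= [b1 b2 qT] q'2 q'1]].
    split=> /=; [|by rewrite eq_w|by rlra].
    split=> /=; [rlra|rlra|].
    case: on_stair => [kn|[lt_kn Dk]].
      by constructor 2; rewrite (_ : w = n); [rewrite subrr | nlia].
    constructor 3; exists k, r; split=> //.
    + case: (ltnP k r) => [|le]; first nlia.
      have eq_rk : r = k by nlia.
      by have := Dr ltac:(nlia); rewrite /= eq_rk Dk.
    + by move=> c c_in; have := nDr c ltac:(nlia); rewrite /= negbK.
    + by rewrite eq_w.
  rewrite q'2 eq_w; split=> //.
  case: qT => [q0|q0|[a [m [am run le_qm le_qa]]]].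
  + by rlra.
  + have kn : k = n by apply/eqP; rewrite -(eqr_nat R); apply/eqP; rlra.
    by rewrite (_ : r = n); [rlra | nlia].
  + have le_km : (k <= m)%N by rewrite -(ler_nat R); rlra.
    have le_ak : (a <= k)%N by rewrite -(ler_nat R); rlra.
    have le_ka : (k <= a)%N by apply: (run_above a m) => //; nlia.
    have le_mr : (m <= r)%N.
      rewrite leqNgt; apply/negP => lt_rm.
      by have := Dr ltac:(nlia); rewrite /= run //; nlia.
    by have := natR_le le_mr; rlra.
- have off_stair : (k < n)%N /\ ~~ D k.+1.
    have [lt_kn|le_nk] := ltnP k n; split=> //.
    + apply/negP => Dk; apply: kT; rewrite inE; split=> /=; [rlra|rlra|].
      constructor 3; exists k, k.+1; split=> //; first nlia.
      - by move=> c c_in; have -> : c = k.+1 by nlia.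
      - by rewrite ler_nat.
    + by exfalso; apply: kT; rewrite inE; split=> /=; [rlra|rlra|constructor 2];
         rewrite (_ : k = n); [rewrite subrr | nlia].
    + by exfalso; apply: kT; rewrite inE; split=> /=; [rlra|rlra|constructor 2];
         rewrite (_ : k = n); [rewrite subrr | nlia].
  case: off_stair => lt_kn nDk1.
  have eq_r : r = k.
    by case: (ltngtP k r) => //; [move=> lt; move: (nDr k.+1); rewrite /= nDk1; nlia | nlia].
  have lt_kw : (k < w)%N.
    rewrite ltn_neqAle; apply/andP; split; last nlia.
    by apply: contra nDk1 => /eqP eq_wk; rewrite eq_wk; apply: Dw; nlia.
  apply: highestE => [|q' [/= [b1 b2 qT] q'1 q'2]].
    split=> /=; [|by rewrite eq_r|by rewrite ltrD2l ltrN2 ltr_nat].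
    split=> /=; [rlra|rlra|].
    have [->|ne_wn] := eqVneq w n; first by constructor 2; rewrite subrr.
    constructor 3; exists w, w.+1; split=> //; first nlia.
    + by move=> c c_in; rewrite (_ : c = w.+1); [apply: Dw | nlia]; nlia.
    + by rewrite eq_r ler_nat; nlia.
  rewrite q'1 eq_r; split=> //.
  case: qT => [q0|q0|[a [m [am run le_qm le_qa]]]].
  + by rlra.
  + by rlra.
  + have le_km : (k <= m)%N by rewrite -(ler_nat R); rlra.
    have le_ka : (k <= a)%N by apply: (run_above a m) => //; nlia.
    have le_wa : (w <= a)%N.
      rewrite leqNgt; apply/negP => lt_aw.
      by have := nDw a.+1 ltac:(nlia); rewrite run //; nlia.
    by have := natR_le le_wa; rlra.
Qed.

Lemma next_rect_cell rs D k : drawn n rs = staircase D -> (0 < k <= n)%N -> ~~ D k ->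
  next_rect n rs k = cell D k.
Proof.
move=> eqT k_in nDk.
rewrite [LHS]surjective_pairing [RHS]surjective_pairing.
by rewrite (top_left_corner eqT) // (bottom_right_corner eqT).
Qed.

(** Reading [k] merges the runs on both sides of it into the run from [u.+1] to [r], whose top-right
    corner is that of the new rectangle. The part of the new region outside this rectangle, to the
    left of [l] or below the height of [w], was already drawn. *)
Lemma staircase_add D k : (0 < k <= n)%N -> ~~ D k ->
  staircase (predU1 k D) = staircase D `|` region (cell D k).
Proof.
move=> k_in nDk.
have [lt_l Dl nDl] := pred_nearestP D (proj1 (andP k_in)).
have [lt_u Du nDu] := pred_nearestP (predC D) (proj1 (andP k_in)).
have [le_w Dw nDw] := before_nextP D (proj2 (andP k_in)).
have [le_r Dr nDr] := before_nextP (predC D) (proj2 (andP k_in)).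
rewrite /cell /region /=.
set l := pred_nearest D k in lt_l Dl nDl *.
set u := pred_nearest _ k in lt_u Du nDu *; clearbody l u.
set w := before_next n D k in le_w Dw nDw *.
set r := before_next n _ k in le_r Dr nDr *; clearbody w r.
have R0l := natR_le (leq0n l); have R0u := natR_le (leq0n u).
have Rrn : r%:R <= n%:R :> R by apply: natR_le; nlia.
have Rwn : w%:R <= n%:R :> R by apply: natR_le; nlia.
apply/seteqP; split=> q /=.
- move=> [b1 b2 [q0|q0|[a [m [am run le_qm le_qa]]]]].
  + by left; split=> //; constructor 1.
  + by left; split=> //; constructor 2.
  have [/andP[lt_ak le_km]|out] := boolP (a < k <= m)%N; last first.
    left; split=> //; constructor 3; exists a, m; split=> // c c_in.
    by have /predU1P[eq_ck|//] := run c c_in; nlia.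
  have runD c : (a < c <= m)%N -> c != k -> D c.
    by move=> c_in ne_ck; have /predU1P[/eqP|//] := run c c_in; rewrite (negPf ne_ck).
  have le_ua : (u <= a)%N.
    rewrite leqNgt; apply/negP => lt_au.
    by have := Du ltac:(nlia); rewrite /= runD //; nlia.
  have le_mr : (m <= r)%N.
    rewrite leqNgt; apply/negP => lt_rm.
    by have := Dr ltac:(nlia); rewrite /= runD //; nlia.
  have := natR_le le_ua; have := natR_le le_mr => Rmr Rua.
  have [le_lq|lt_ql] := leP l%:R q.1; last first.
    have l_gt0 : (0 < l)%N by rewrite -(ltr_nat R); rlra.
    (* To the left of the rectangle: the old run is cut off at [l], or is [l] alone if [a] is not
       below [l]. *)
    left; split=> //; constructor 3; exists (minn a l.-1), l; split=> //; first nlia.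
    + move=> c c_in; have [lt_ac|le_ca] := ltnP a c; first by apply: runD; nlia.
      by rewrite (_ : c = l); [apply: Dl | nlia]; nlia.
    + by rlra.
    + have [le_al|lt_la] := leqP a l.-1; first by [].
      by have := natR_le (ltnW lt_la); rlra.
  have [le_wq|lt_qw] := leP (n%:R - w%:R) q.2; first by right; split; rlra.
  have lt_wn : (w < n)%N by rewrite -(ltr_nat R); rlra.
  (* Below the rectangle: the run now starts after [w], and [w.+1] is in [D], so the run is
     nonempty. *)
  left; split=> //; constructor 3; exists w, (maxn m w.+1); split=> //; first nlia.
  + move=> c c_in; have [le_cm|lt_mc] := leqP c m; first by apply: runD; nlia.
    by rewrite (_ : c = w.+1); [apply: Dw | nlia]; nlia.
  + by have := natR_le (leq_maxl m w.+1); rlra.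
  + by rlra.
- case=> [[b1 b2 qT]|[q1 q2]].
    split=> //; case: qT => [q0|q0|[a [m [am run le_qm le_qa]]]];
      [by constructor 1|by constructor 2|].
    by constructor 3; exists a, m; split=> // c c_in; rewrite /= run ?orbT.
  split; [rlra|rlra|constructor 3]; exists u, r; split; [nlia| |rlra|rlra].
  move=> c c_in; have [lt_ck|lt_kc|->] := ltngtP c k; last exact: predU1l.
  - by have := nDu c ltac:(nlia); rewrite /= negbK => Dc; rewrite Dc orbT.
  - by have := nDr c ltac:(nlia); rewrite /= negbK => Dc; rewrite Dc orbT.
Qed.

Lemma drawn_rcons rs r : drawn n (rcons rs r) = drawn n rs `|` region r.
Proof.
apply/seteqP; split=> q /=; rewrite /drawn /=.
- case=> [?|[r']]; first by do 2 left.
  rewrite mem_rcons inE => /predU1P[->|r'_in] rq; first by right.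
  by left; right; exists r'.
- case=> [[?|[r' r'_in rq]]|rq]; first by left.
  + by right; exists r' => //; rewrite mem_rcons inE r'_in orbT.
  + by right; exists r => //; rewrite mem_rcons inE eqxx.
Qed.

Lemma drawn_nil : drawn n ([::] : seq rect) = staircase pred0.
Proof.
have R0n := natR_le (leq0n n).
apply/seteqP; split=> q /=; rewrite /drawn /region /=.
- case=> [[[q1 q2]|[q1 q2]]|[r //]].
  + by split; [rlra|rlra|constructor 1; rlra].
  + by split; [rlra|rlra|constructor 2; rlra].
- case=> b1 b2 [q0|q0|[a [m [am run _ _]]]].
  + by do 2 left; split; rlra.
  + by left; right; split; rlra.
  + by have := run m; rewrite /=; have -> : (a < m <= m)%N; [nlia | move=> /(_ isT)].
Qed.

Lemma staircase_ext D D' : (forall c, D c = D' c) -> staircase D = staircase D'.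
Proof. by move=> /funext ->. Qed.

Definition draw s := foldl (fun rs k => rcons rs (next_rect n rs k)) [::] s.

Lemma drawP s : uniq s -> {in s, forall k, 0 < k <= n}%N ->
  drawn n (draw s) = staircase (fun c => c \in s) /\
  draw s = [seq cell (fun c => index c s < index k s)%N k | k <- s].
Proof.
elim/last_ind: s => [_ _|s k IHs]; first by rewrite drawn_nil.
rewrite rcons_uniq => /andP[k_notin uniq_s] s_in.
have k_in : (0 < k <= n)%N by apply: s_in; rewrite mem_rcons inE eqxx.
have [|eqT eq_draw] := IHs uniq_s.
  by move=> c c_in; apply: s_in; rewrite mem_rcons inE c_in orbT.
have draw_rcons : draw (rcons s k) = rcons (draw s) (cell (fun c => c \in s) k).
  rewrite /draw foldl_rcons; congr rcons; exact: (next_rect_cell eqT).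
rewrite draw_rcons; split.
  rewrite drawn_rcons eqT -staircase_add //; apply: staircase_ext => c /=.
  by rewrite mem_rcons.
(* A number outside [s] has index at least [size s], so appending [k] does not change the set of
   labels before an earlier label. *)
rewrite map_rcons eq_draw; congr rcons.
  apply/eq_in_map => c c_in; congr (cell _ c); apply/funext => d.
  rewrite -!cats1 !index_cat c_in; case: ifP => // d_in.
  have := index_mem c s; rewrite c_in => lt_c.
  by apply/idP/idP; have := memNindex (negbT d_in); nlia.
congr (cell _ k); apply/funext => d.
rewrite -cats1 !index_cat (negPf k_notin) /= eqxx addn0.
by case: ifP => [|d_in]; [rewrite index_mem => -> | nlia].
Qed.

End Drawing.

(** * Walls *)

Section DiagonalRectangulation.
Local Open Scope classical_set_scope.
Local Open Scope ring_scope.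
Variables (R : realType) (n : nat) (pos : nat -> nat).
Hypothesis ho : label_order n pos.
Local Notation plane := (R * R)%type.
Local Notation rect := (plane * plane)%type.
Implicit Types (q : plane) (W : rect) (i j k : nat).

Definition rectangle k : rect :=
  (((left_of pos k)%:R, n%:R - (top_of pos k)%:R),
   ((right_of n pos k)%:R, n%:R - (bottom_of n pos k)%:R)).

Definition rectangles : set rect :=
  [set rectangle k | k in [set k | (0 < k <= n)%N]].

(* The wall through [p_i]. *)
Definition diagonal_wall i : rect :=
  if (pos i < pos i.+1)%N
  then ((i%:R, n%:R - (top_of pos i.+1)%:R), (i%:R, n%:R - (bottom_of n pos i)%:R))
  else (((left_of pos i.+1)%:R, n%:R - i%:R), ((right_of n pos i)%:R, n%:R - i%:R)).

Lemma cell_rectangle k : (0 < k <= n)%N ->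
  cell R n (fun c => pos c < pos k)%N k = rectangle k.
Proof.
move=> k_in; have notE c : (0 < c <= n)%N -> c != k ->
    predC (fun c => pos c < pos k)%N c = (pos k < pos c)%N.
  move=> c_in ne_ck; apply/idP/idP => /=; last by rewrite -leqNgt => /ltnW.
  by move=> nlt; apply: (posNlt ho).
rewrite /cell /rectangle; congr ((_, _ - _%:R), (_%:R, _)).
- by apply: eq_pred_nearest => [|c c_in]; [nlia | apply: notE; nlia].
- by apply: eq_before_next => [|c c_in]; [nlia | apply: notE; nlia].
Qed.

Lemma rectangle_bounds k : (0 < k <= n)%N ->
  [/\ (left_of pos k < k)%N, (top_of pos k < k)%N,
      (k <= right_of n pos k <= n)%N & (k <= bottom_of n pos k <= n)%N].
Proof.
move=> k_in; have [? _ _] := left_ofP ho k_in; have [? _ _] := top_ofP ho k_in.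
by have [? _ _] := right_ofP ho k_in; have [? _ _] := bottom_ofP ho k_in.
Qed.

Lemma boundaryP W q : boundary W q <->
  region W q /\ [\/ q.1 = W.1.1, q.1 = W.2.1, q.2 = W.1.2 | q.2 = W.2.2].
Proof.
rewrite /boundary /region /interior_region /=; split.
- move=> [[q1 q2] nint]; split=> //.
  have [->|ne1] := eqVneq q.1 W.1.1; first by constructor 1.
  have [->|ne2] := eqVneq q.1 W.2.1; first by constructor 2.
  have [->|ne3] := eqVneq q.2 W.1.2; first by constructor 3.
  have [->|ne4] := eqVneq q.2 W.2.2; first by constructor 4.
  case: nint; rewrite !lt_neqAle [W.1.1 == _]eq_sym [W.2.2 == _]eq_sym ne1 ne2 ne3 ne4 /=.
  by move: q1 q2 => /andP[-> ->] /andP[-> ->].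
- by move=> [[q1 q2] sides]; split=> // -[q1' q2']; case: sides; lra.
Qed.

Lemma nonint_between (a b : R) : a < b ->
  exists t, [/\ a < t, t < b & t \isn't a Num.int].
Proof.
move=> lt_ab; have /andP[le_fa lt_af] := floor_itv a.
set f := Num.floor a in le_fa lt_af.
have lt_am : a < Num.min b (f + 1)%:~R by rewrite lt_min lt_ab.
have le_mb : Num.min b (f + 1)%:~R <= b by rewrite ge_min lexx.
have le_mf : Num.min b (f + 1)%:~R <= (f + 1)%:~R by rewrite ge_min lexx orbT.
(* The midpoint lies strictly between the consecutive integers [f] and [f + 1]. *)
exists ((a + Num.min b (f + 1)%:~R) / 2); split; [lra|lra|].
apply/negP => /intrP[z eq_z].
have lt_fz : (f < z)%R by rewrite -(ltr_int R) -eq_z; lra.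
have lt_zf : (z < f + 1)%R by rewrite -(ltr_int R) -eq_z; lra.
by move: lt_fz lt_zf; lia.
Qed.

Lemma subr_nat_int i : n%:R - i%:R \is a @Num.int R.
Proof. by rewrite rpredB // natr_int. Qed.

(** All corners are integral, so a non-integral height rules out the top and bottom sides. A left or
    right side lies on an edge of the square or, by the side-in-wall lemmas, on a diagonal wall. *)
Lemma rectangles_edges_vertical q :
  (\bigcup_(r in rectangles) boundary r) q -> q.2 \isn't a Num.int ->
  [\/ q.1 = 0, q.1 = n%:R | exists i, [/\ (0 < i < n)%N, (pos i < pos i.+1)%N, q.1 = i%:R
    & n%:R - (bottom_of n pos i)%:R <= q.2 <= n%:R - (top_of pos i.+1)%:R]].
Proof.
move=> [r [k /= k_in <-] /boundaryP[[q1 q2] sides]] nint.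
have [lt_l lt_t le_r le_b] := rectangle_bounds k_in.
case: sides => /= [eq_q|eq_q|eq_q|eq_q].
- have [l0|l_gt0] := posnP (left_of pos k); first by constructor 1; rewrite eq_q l0.
  have [lt_pos /(natR_le R) le_top /(natR_le R) le_bot] := left_side_in_wall ho k_in l_gt0.
  constructor 3; exists (left_of pos k); split=> //; first by nlia.
  by move: q2 => /= /andP[? ?]; apply/andP; split; rlra.
- have [rn|ne_rn] := eqVneq (right_of n pos k) n; first by constructor 2; rewrite eq_q rn.
  have lt_rn : (right_of n pos k < n)%N by nlia.
  have [lt_pos /(natR_le R) le_top /(natR_le R) le_bot] := right_side_in_wall ho k_in lt_rn.
  constructor 3; exists (right_of n pos k); split=> //; first by nlia.
  by move: q2 => /= /andP[? ?]; apply/andP; split; rlra.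
- by rewrite eq_q subr_nat_int in nint.
- by rewrite eq_q subr_nat_int in nint.
Qed.

Lemma rectangles_edges_horizontal q :
  (\bigcup_(r in rectangles) boundary r) q -> q.1 \isn't a Num.int ->
  [\/ q.2 = n%:R, q.2 = 0 | exists i, [/\ (0 < i < n)%N, (pos i.+1 < pos i)%N,
    q.2 = n%:R - i%:R & (left_of pos i.+1)%:R <= q.1 <= (right_of n pos i)%:R]].
Proof.
move=> [r [k /= k_in <-] /boundaryP[[q1 q2] sides]] nint.
have [lt_l lt_t le_r le_b] := rectangle_bounds k_in.
case: sides => /= [eq_q|eq_q|eq_q|eq_q].
- by rewrite eq_q natr_int in nint.
- by rewrite eq_q natr_int in nint.
- have [t0|t_gt0] := posnP (top_of pos k); first by constructor 1; rewrite eq_q t0 subr0.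
  have [lt_pos /(natR_le R) le_l /(natR_le R) le_r'] := top_side_in_wall ho k_in t_gt0.
  constructor 3; exists (top_of pos k); split=> //; first by nlia.
  by move: q1 => /= /andP[? ?]; apply/andP; split; rlra.
- have [bn|ne_bn] := eqVneq (bottom_of n pos k) n.
    by constructor 2; rewrite eq_q bn subrr.
  have lt_bn : (bottom_of n pos k < n)%N by nlia.
  have [lt_pos /(natR_le R) le_l /(natR_le R) le_r'] := bottom_side_in_wall ho k_in lt_bn.
  constructor 3; exists (bottom_of n pos k); split=> //; first by nlia.
  by move: q1 => /= /andP[? ?]; apply/andP; split; rlra.
Qed.

Lemma rectangle_in_square k q : (0 < k <= n)%N -> region (rectangle k) q ->
  region (square R n) q.
Proof.
move=> k_in; have [lt_l lt_t le_r le_b] := rectangle_bounds k_in; rewrite /region /=.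
have := natR_le R (leq0n (left_of pos k)); have := natR_le R (leq0n (top_of pos k)).
have := natR_le R (proj2 (andP le_r)); have := natR_le R (proj2 (andP le_b)).
by move=> ? ? ? ? [q1 q2]; split; rlra.
Qed.

Lemma boundary_in_square q :
  (\bigcup_(r in rectangles) boundary r) q -> region (square R n) q.
Proof. by move=> [r [k /= k_in <-] [rq _]]; apply: rectangle_in_square rq. Qed.

Definition square_edges : seq rect :=
  [:: left_edge R n; bottom_edge R n; right_edge R n; top_edge R n].

(* A segment contains points with a non-integral coordinate arbitrarily close to
   each of its points, and such points of the boundary lie on a unique line. *)
Lemma boundary_segment_sub W : boundary_segment rectangles W ->
  exists2 W0, W0 \in square_edges \/ (exists2 i, (0 < i < n)%N & W0 = diagonal_wall i)
    & region W `<=` region W0.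
Proof.
move=> [[[eq_c lt_y]|[eq_c lt_x]] subE].
- have onW y : W.2.2 <= y <= W.1.2 -> region W (W.1.1, y).
    by move=> y_in; split=> //=; rewrite -eq_c lexx.
  have inS q : region W q -> [/\ q.1 = W.1.1, W.2.2 <= q.2 <= W.1.2 & region (square R n) q].
    move=> Wq; split; last exact/boundary_in_square/subE.
      by case: Wq => /= [q1 _]; rewrite -eq_c in q1; lra.
    by case: Wq.
  have [y [lt1 lt2 nint]] := nonint_between lt_y.
  have := @rectangles_edges_vertical (W.1.1, y) (subE _ (onW y _)) nint.
  case=> /= [|c0|cn|[i [i_in lt_pos ci _]]]; first by lra.
  + exists (left_edge R n); first by left; rewrite !inE eqxx.
    by move=> q /inS[q1 q2 [q1' q2']]; split=> //=; move: q1' q2' => /=; lra.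
  + exists (right_edge R n); first by left; rewrite !inE eqxx !orbT.
    by move=> q /inS[q1 q2 [q1' q2']]; split=> //=; move: q1' q2' => /=; lra.
  have i_lt_n : i%:R < n%:R :> R by rewrite ltr_nat; nlia.
  have i_gt0 : 0 < i%:R :> R by rewrite ltr0n; nlia.
  (* The common abscissa determines [i], so all non-integral heights of [W] belong to one wall. If
     [W] stuck out of this wall, the excess would contain such a height. *)
  have in_wall z : W.2.2 < z < W.1.2 -> z \isn't a Num.int ->
      n%:R - (bottom_of n pos i)%:R <= z <= n%:R - (top_of pos i.+1)%:R.
    move=> z_in zint; have := @rectangles_edges_vertical (W.1.1, z) (subE _ (onW z _)) zint.
    case=> /= [|c0|cn|[j [_ _ cj z_in']]]; [lra|exfalso; lra|exfalso; lra|].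
    by have <- : j = i by apply/eqP; rewrite -(eqr_nat R) -ci -cj.
  exists (diagonal_wall i); first by right; exists i.
  rewrite /diagonal_wall lt_pos => q /inS[q1 q2 _]; split=> /=; first by rewrite q1 ci lexx.
  have le_bot : n%:R - (bottom_of n pos i)%:R <= W.2.2.
    rewrite leNgt; apply/negP => lt_b.
    have [|z [z1 z2 zint]] := @nonint_between W.2.2
      (Num.min W.1.2 (n%:R - (bottom_of n pos i)%:R)); first by rewrite lt_min lt_y.
    move: z2; rewrite lt_min => /andP[z2 z3].
    by have := in_wall z _ zint; rewrite z1 z2 => /(_ isT); lra.
  have le_top : W.1.2 <= n%:R - (top_of pos i.+1)%:R.
    rewrite leNgt; apply/negP => lt_t.
    have [|z [z1 z2 zint]] := @nonint_between
      (Num.max W.2.2 (n%:R - (top_of pos i.+1)%:R)) W.1.2; first by rewrite gt_max lt_y.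
    move: z1; rewrite gt_max => /andP[z1 z3].
    by have := in_wall z _ zint; rewrite z1 z2 => /(_ isT); lra.
  by lra.
- have onW x : W.1.1 <= x <= W.2.1 -> region W (x, W.1.2).
    by move=> x_in; split=> //=; rewrite -eq_c lexx.
  have inS q : region W q -> [/\ q.2 = W.1.2, W.1.1 <= q.1 <= W.2.1 & region (square R n) q].
    move=> Wq; split; last exact/boundary_in_square/subE.
      by case: Wq => /= [_ q2]; rewrite -eq_c in q2; lra.
    by case: Wq.
  have [x [lt1 lt2 nint]] := nonint_between lt_x.
  have := @rectangles_edges_horizontal (x, W.1.2) (subE _ (onW x _)) nint.
  case=> /= [|cn|c0|[i [i_in lt_pos ci _]]]; first by lra.
  + exists (top_edge R n); first by left; rewrite !inE eqxx !orbT.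
    by move=> q /inS[q2 q1 [q1' q2']]; split=> //=; move: q1' q2' => /=; lra.
  + exists (bottom_edge R n); first by left; rewrite !inE eqxx !orbT.
    by move=> q /inS[q2 q1 [q1' q2']]; split=> //=; move: q1' q2' => /=; lra.
  have i_lt_n : i%:R < n%:R :> R by rewrite ltr_nat; nlia.
  have i_gt0 : 0 < i%:R :> R by rewrite ltr0n; nlia.
  have in_wall z : W.1.1 < z < W.2.1 -> z \isn't a Num.int ->
      (left_of pos i.+1)%:R <= z <= (right_of n pos i)%:R.
    move=> z_in zint; have := @rectangles_edges_horizontal (z, W.1.2) (subE _ (onW z _)) zint.
    case=> /= [|cn|c0|[j [_ _ cj z_in']]]; [lra|exfalso; lra|exfalso; lra|].
    have <- // : j = i by apply/eqP; rewrite -(eqr_nat R); apply/eqP; lra.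
  exists (diagonal_wall i); first by right; exists i.
  rewrite /diagonal_wall ifN; last by rewrite -leqNgt ltnW.
  move=> q /inS[q2 q1 _]; split=> /=; last by rewrite q2 ci lexx.
  have le_l : (left_of pos i.+1)%:R <= W.1.1.
    rewrite leNgt; apply/negP => lt_l.
    have [|z [z1 z2 zint]] := @nonint_between W.1.1
      (Num.min W.2.1 (left_of pos i.+1)%:R); first by rewrite lt_min lt_x.
    move: z2; rewrite lt_min => /andP[z2 z3].
    by have := in_wall z _ zint; rewrite z1 z2 => /(_ isT); lra.
  have le_r : W.2.1 <= (right_of n pos i)%:R.
    rewrite leNgt; apply/negP => lt_r.
    have [|z [z1 z2 zint]] := @nonint_between
      (Num.max W.1.1 (right_of n pos i)%:R) W.2.1; first by rewrite gt_max lt_x.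
    move: z1; rewrite gt_max => /andP[z1 z3].
    by have := in_wall z _ zint; rewrite z1 z2 => /(_ isT); lra.
  by lra.
Qed.

(** A vertical wall could degenerate only if [bottom_of n pos i] were [i], which would put [i.+1]
    before [i]. The horizontal case is the same with [right_of]. *)
Lemma diagonal_wall_segment i : (0 < i < n)%N -> is_segment (diagonal_wall i).
Proof.
move=> i_in; rewrite /diagonal_wall /is_segment.
have [_ t_lt _ _] := @rectangle_bounds i.+1 ltac:(nlia).
have [_ _ _ b_ge] := @rectangle_bounds i ltac:(nlia).
have [l_lt _ _ _] := @rectangle_bounds i.+1 ltac:(nlia).
have [_ _ r_ge _] := @rectangle_bounds i ltac:(nlia).
case: ifPn => [lt_pos|].
- left; split=> //=; rewrite ltrD2l ltrN2 ltr_nat.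
  have [_ Pb nb] := @bottom_ofP _ _ ho i ltac:(nlia).
  have [_ Pt nt] := @top_ofP _ _ ho i.+1 ltac:(nlia).
  rewrite ltnNge; apply/negP => le_bt.
  have eq_b : bottom_of n pos i = i by nlia.
  by have := Pb ltac:(nlia); rewrite eq_b; nlia.
- rewrite -leqNgt leq_eqVlt => /predU1P[eq_pos|lt_pos].
    by have := (proj2 ho) i.+1 i ltac:(nlia) ltac:(nlia) eq_pos; nlia.
  right; split=> //=; rewrite ltr_nat.
  have [_ Pr nr] := @right_ofP _ _ ho i ltac:(nlia).
  rewrite ltnNge; apply/negP => le_rl.
  have eq_r : right_of n pos i = i by nlia.
  by have := Pr ltac:(nlia); rewrite eq_r; nlia.
Qed.

(** The point [pt n i] cuts the wall in two: the half above it, or to its left, lies in a side of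
    rectangle [i.+1], the other half in a side of rectangle [i]. *)
Lemma diagonal_wall_sub_boundary i : (0 < i < n)%N ->
  region (diagonal_wall i) `<=` \bigcup_(r in rectangles) boundary r.
Proof.
move=> i_in q; rewrite /diagonal_wall.
have [l_lt t_lt r_ge b_ge] := @rectangle_bounds i.+1 ltac:(nlia).
have [l_lt' t_lt' r_ge' b_ge'] := @rectangle_bounds i ltac:(nlia).
case: ifPn => [lt_pos|]; rewrite /region /=.
- move=> [q1 q2]; have eq_q1 : q.1 = i%:R by rlra.
  have [le_q|lt_q] := leP (n%:R - i%:R) q.2.
  + exists (rectangle i.+1); first by exists i.+1 => //=; nlia.
    have eq_l := @left_of_succ n pos i i_in lt_pos.
    have Rb : i%:R <= (bottom_of n pos i.+1)%:R :> R by apply: natR_le; nlia.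
    have Rr : i%:R <= (right_of n pos i.+1)%:R :> R by apply: natR_le; nlia.
    apply/boundaryP; split; last by constructor 1; rewrite /= eq_l.
    by rewrite /region /= eq_l; split; rlra.
  + exists (rectangle i); first by exists i => //=; nlia.
    have eq_r := @right_of_prev n pos i i_in lt_pos.
    have Rt : (top_of pos i)%:R <= i%:R :> R by apply: natR_le; nlia.
    have Rl : (left_of pos i)%:R <= i%:R :> R by apply: natR_le; nlia.
    apply/boundaryP; split; last by constructor 2; rewrite /= eq_r.
    by rewrite /region /= eq_r; split; rlra.
- rewrite -leqNgt leq_eqVlt => /predU1P[eq_pos|lt_pos].
    by have := (proj2 ho) i.+1 i ltac:(nlia) ltac:(nlia) eq_pos; nlia.
  move=> [q1 q2]; have eq_q2 : q.2 = n%:R - i%:R by rlra.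
  have [le_q|lt_q] := leP q.1 i%:R.
  + exists (rectangle i.+1); first by exists i.+1 => //=; nlia.
    have eq_t := top_of_succ ho i_in lt_pos.
    have Rb : i%:R <= (bottom_of n pos i.+1)%:R :> R by apply: natR_le; nlia.
    have Rr : i%:R <= (right_of n pos i.+1)%:R :> R by apply: natR_le; nlia.
    apply/boundaryP; split; last by constructor 3; rewrite /= eq_t.
    by rewrite /region /= eq_t; split; rlra.
  + exists (rectangle i); first by exists i => //=; nlia.
    have eq_b := bottom_of_prev ho i_in lt_pos.
    have Rt : (top_of pos i)%:R <= i%:R :> R by apply: natR_le; nlia.
    have Rl : (left_of pos i)%:R <= i%:R :> R by apply: natR_le; nlia.
    apply/boundaryP; split; last by constructor 4; rewrite /= eq_b.
    by rewrite /region /= eq_b; split; rlra.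
Qed.

Lemma diagonal_wall_pt i j : (0 < i < n)%N -> (0 < j < n)%N ->
  region (diagonal_wall i) (pt R n j) <-> i = j.
Proof.
move=> i_in j_in; rewrite /diagonal_wall.
have [_ t_lt _ _] := @rectangle_bounds i.+1 ltac:(nlia).
have [_ _ _ b_ge] := @rectangle_bounds i ltac:(nlia).
have [l_lt _ _ _] := @rectangle_bounds i.+1 ltac:(nlia).
have [_ _ r_ge _] := @rectangle_bounds i ltac:(nlia).
split=> [|<-]; case: ifP => _; rewrite /region /= ?lerD2l ?lerN2 ?ler_nat; nlia.
Qed.

Lemma square_edges_pt W i : (0 < i < n)%N -> W \in square_edges -> ~ region W (pt R n i).
Proof.
move=> i_in; have i_gt0 : 0 < i%:R :> R by rewrite ltr0n; nlia.
have i_lt_n : i%:R < n%:R :> R by rewrite ltr_nat; nlia.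
by rewrite !inE => /or4P[] /eqP->; rewrite /region /=; rlra.
Qed.

Lemma segment_ordered W : is_segment W -> W.1.1 <= W.2.1 /\ W.2.2 <= W.1.2.
Proof. by case=> -[-> /ltW ?]; split. Qed.

Lemma segment_region_anti W W' : is_segment W -> is_segment W' ->
  region W `<=` region W' -> region W' `<=` region W -> W = W'.
Proof.
move=> /segment_ordered[lex ley] /segment_ordered[lex' ley'] sub sub'.
have [/= h1 h2] := sub (W.1.1, W.1.2) ltac:(by split; rewrite /= lexx ?lex ?ley).
have [/= h3 h4] := sub (W.2.1, W.2.2) ltac:(by split; rewrite /= lexx ?lex ?ley).
have [/= h5 h6] := sub' (W'.1.1, W'.1.2) ltac:(by split; rewrite /= lexx ?lex' ?ley').
have [/= h7 h8] := sub' (W'.2.1, W'.2.2) ltac:(by split; rewrite /= lexx ?lex' ?ley').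
move: W W' {sub sub'} lex ley lex' ley' h1 h2 h3 h4 h5 h6 h7 h8.
by move=> [[? ?] [? ?]] [[? ?] [? ?]] /= *; congr ((_, _), (_, _)); lra.
Qed.

(** * Subdivision and walls, given that the rectangles cover the square *)

Section Cover.
Hypothesis n_gt0 : (0 < n)%N.
(** The left and bottom edges are excluded because [drawn] contains them before any rectangle, so
    the drawing tells nothing about the rectangles there. *)
Hypothesis cover_interior : forall q, 0 < q.1 <= n%:R -> 0 < q.2 <= n%:R ->
  exists2 k, (0 < k <= n)%N & region (rectangle k) q.

Lemma unit_interval (x : R) : 0 <= x <= n%:R ->
  exists2 i, (0 < i <= n)%N & i%:R - 1 <= x <= i%:R.
Proof.
elim: n n_gt0 => // m IHm _ x_in; have [m0|m_gt0] := posnP m.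
  by exists 1%N => //; rewrite m0 in x_in; lra.
have m1 : m.+1%:R = m%:R + 1 :> R by rewrite -natr1.
have [le_xm|lt_mx] := leP x m%:R; last by exists m.+1; [nlia | rlra].
by have [|i i_in ?] := IHm m_gt0; [lra | exists i => //; nlia].
Qed.

(* The center of a unit cell is not on the edges of the square, and a rectangle
   with integral corners that contains it contains the whole cell. *)
Lemma rectangles_cover q : region (square R n) q ->
  exists2 k, (0 < k <= n)%N & region (rectangle k) q.
Proof.
move=> [/= /unit_interval[i i_in q1] q2].
have [|j j_in q2'] := @unit_interval (n%:R - q.2); first by lra.
have i1 : 1%:R <= i%:R :> R by apply: natR_le; nlia.
have j1 : 1%:R <= j%:R :> R by apply: natR_le; nlia.
have in_ : i%:R <= n%:R :> R by apply: natR_le; nlia.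
have jn : j%:R <= n%:R :> R by apply: natR_le; nlia.
have [||k k_in [/= k1 k2]] := @cover_interior (i%:R - 2^-1, n%:R - j%:R + 2^-1).
- by rewrite /=; rlra.
- by rewrite /=; rlra.
exists k => //.
have ltl : (left_of pos k < i)%N by rewrite -(ltr_nat R); rlra.
have ltt : (top_of pos k < j)%N by rewrite -(ltr_nat R); rlra.
have ler : (i <= right_of n pos k)%N.
  by rewrite -ltnS -(ltr_nat R) -natr1; rlra.
have leb : (j <= bottom_of n pos k)%N.
  by rewrite -ltnS -(ltr_nat R) -natr1; rlra.
have := natR_le R ltl; have := natR_le R ltt; have := natR_le R ler; have := natR_le R leb.
by rewrite -!natr1 /region /= => *; split; rlra.
Qed.

Lemma rectangles_subdivision : is_subdivision n rectangles.
Proof.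
split.
- apply: finite_image; apply: sub_finite_set (finite_II n.+1) => k /=; nlia.
- move=> r [k /= k_in <-]; have [lt_l lt_t le_r le_b] := rectangle_bounds k_in.
  by split; rewrite /= ?ltrD2l ?ltrN2 ltr_nat; nlia.
- apply/seteqP; split=> q.
    by move=> [r [k /= k_in <-]]; apply: rectangle_in_square.
  by move=> /rectangles_cover[k k_in kq]; exists (rectangle k) => //; exists k.
- move=> r r' [j /= j_in <-] [k /= k_in <-] ne_jk; apply/seteqP; split=> // q.
  wlog lt_jk : j k j_in k_in ne_jk / (j < k)%N.
    move=> wl; have [|lt_kj|eq_jk] := ltngtP j k; first exact: wl.
      by move=> [qj qk]; apply: (wl k j k_in j_in) => //; apply: nesym.
    by rewrite eq_jk in ne_jk.
  move=> [[/= qj1 qj2] [/= qk1 qk2]].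
  have [lt_pos|le_pos] := ltnP (pos j) (pos k).
    by have /(natR_le R) := @right_of_le_left _ _ ho j k ltac:(nlia) lt_jk ltac:(nlia) lt_pos; rlra.
  have ne_pos : pos j <> pos k by move/(proj2 ho j k j_in k_in); nlia.
  have := @bottom_of_le_top _ _ ho j k ltac:(nlia) lt_jk ltac:(nlia) ltac:(nlia).
  by move=> /(natR_le R); rlra.
Qed.

Lemma square_edge_boundary_segment W : W \in square_edges -> boundary_segment rectangles W.
Proof.
have n0 : 0 < n%:R :> R by rewrite ltr0n.
move=> W_in; split.
  by move: W_in; rewrite !inE => /or4P[] /eqP->; rewrite /is_segment /=;
     [left | right | left | right]; split; rlra.
move=> q Wq; have sq : region (square R n) q.
  by move: W_in Wq; rewrite !inE => /or4P[] /eqP->; rewrite /region /= => -[? ?]; split; rlra.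
have [k k_in kq] := rectangles_cover sq.
have [lt_l lt_t le_r le_b] := rectangle_bounds k_in.
have Rr := natR_le R (proj2 (andP le_r)); have Rb := natR_le R (proj2 (andP le_b)).
have Rl := natR_le R (leq0n (left_of pos k)); have Rt := natR_le R (leq0n (top_of pos k)).
exists (rectangle k); first by exists k.
apply/boundaryP; split=> //; move: kq W_in Wq; rewrite !inE /region /=.
move=> [k1 k2] /or4P[] /eqP-> /= [q1 q2].
- by constructor 1; rlra.
- by constructor 4; rlra.
- by constructor 2; rlra.
- by constructor 3; rlra.
Qed.

Lemma diagonal_wall_boundary_segment i : (0 < i < n)%N ->
  boundary_segment rectangles (diagonal_wall i).
Proof.
by move=> i_in; split; [exact: diagonal_wall_segment | exact: diagonal_wall_sub_boundary].
Qed.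

(** Every boundary segment lies in an edge or in a diagonal wall, so a maximal one that is not an
    edge is a diagonal wall. Conversely [pt n i] makes its wall maximal: this point is on no edge
    and on no other diagonal wall, so a larger segment can only lie in the same wall. *)
Lemma wallP W :
  wall n rectangles W <-> exists2 i, (0 < i < n)%N & W = diagonal_wall i.
Proof.
split=> [[segW maxW [ne1 ne2 ne3 ne4]]|[i i_in ->]].
- have [W0 [W0_edge|[i i_in eqW0]] subW] := boundary_segment_sub segW.
    have eqW := maxW _ (square_edge_boundary_segment W0_edge) subW.
    by move: W0_edge; rewrite eqW !inE => /or4P[] /eqP.
  rewrite eqW0 in subW; exists i => //.
  by rewrite (maxW _ (diagonal_wall_boundary_segment i_in) subW).
- have pi_in : region (diagonal_wall i) (pt R n i) by apply/diagonal_wall_pt.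
  split; first exact: diagonal_wall_boundary_segment.
    move=> W' segW' subW'.
    have [W0 [W0_edge|[j j_in eqW0]] subW0] := boundary_segment_sub segW'.
      by case: (square_edges_pt i_in W0_edge); apply/subW0/subW'.
    have eq_ji : j = i.
      by apply/(diagonal_wall_pt j_in i_in); rewrite -eqW0; apply/subW0/subW'.
    rewrite eqW0 eq_ji in subW0.
    by apply: segment_region_anti => //; [case: segW' | exact: diagonal_wall_segment].
  have not_edge W' : W' \in square_edges -> diagonal_wall i <> W'.
    by move=> W_in eqW; apply: (square_edges_pt i_in W_in); rewrite -eqW.
  by split; apply: not_edge; rewrite !inE eqxx ?orbT.
Qed.

Lemma diagonal_walls_interiors i j : (0 < i < n)%N -> (0 < j < n)%N -> i <> j ->
  segment_interior (diagonal_wall i) `&` segment_interior (diagonal_wall j) = set0.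
Proof.
have cross i' j' q : (0 < i' < n)%N -> (0 < j' < n)%N ->
    (pos i' < pos i'.+1)%N -> (pos j'.+1 < pos j')%N ->
    segment_interior ((i'%:R, n%:R - (top_of pos i'.+1)%:R),
                      (i'%:R, n%:R - (bottom_of n pos i')%:R)) q ->
    segment_interior (((left_of pos j'.+1)%:R, n%:R - j'%:R),
                      ((right_of n pos j')%:R, n%:R - j'%:R)) q -> False.
  move=> i_in j_in lt_i lt_j [[/= q1 q2] nV] [[/= q1' q2'] nH].
  have eq1 : q.1 = i'%:R by rlra.
  have eq2 : q.2 = n%:R - j'%:R by rlra.
  have eqq : q = (i'%:R, n%:R - j'%:R) by rewrite [q]surjective_pairing eq1 eq2.
  move: q2 q1'; rewrite eqq /= !lerD2l !lerN2 !ler_nat => /andP[le1 le2] /andP[le3 le4].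
  apply: (walls_do_not_cross ho i_in j_in lt_i lt_j).
    rewrite !ltn_neqAle le1 le2 !andbT; apply/andP; split; apply/eqP => eq.
      by apply: nV; left; rewrite eqq eq.
    by apply: nV; right; rewrite eqq -eq.
  rewrite !ltn_neqAle le3 le4 !andbT; apply/andP; split; apply/eqP => eq.
    by apply: nH; left; rewrite eqq eq.
  by apply: nH; right; rewrite eqq -eq.
move=> i_in j_in ne_ij; apply/seteqP; split=> // q; rewrite /diagonal_wall.
have horizontal k : (0 < k < n)%N -> ~~ (pos k < pos k.+1)%N -> (pos k.+1 < pos k)%N.
  by move=> k_in; apply: (posNlt ho); nlia.
case: ifPn => [lt_i|/(horizontal i i_in) lt_i];
  case: ifPn => [lt_j|/(horizontal j j_in) lt_j] [qi qj].
- case: qi qj => [[/= q1 _] _] [[/= q2 _] _]; apply: ne_ij.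
  by apply/eqP; rewrite -(eqr_nat R); apply/eqP; rlra.
- exact: (cross i j q).
- exact: (cross j i q).
- case: qi qj => [[/= _ q1] _] [[/= _ q2] _]; apply: ne_ij.
  by apply/eqP; rewrite -(eqr_nat R); apply/eqP; rlra.
Qed.

Lemma rectangles_dRec : dRec n rectangles.
Proof.
split; first exact: rectangles_subdivision.
- move=> W W' /wallP[i i_in ->] /wallP[j j_in ->] ne_W.
  by apply: diagonal_walls_interiors => // eq_ij; rewrite eq_ij in ne_W.
- by move=> W /wallP[i i_in ->]; exists i => //; apply/diagonal_wall_pt.
- move=> i i_in; exists (diagonal_wall i); split.
    by split; [apply/wallP; exists i | apply/diagonal_wall_pt].
  by move=> W [/wallP[j j_in ->] /diagonal_wall_pt -> //].
Qed.

End Cover.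
End DiagonalRectangulation.

Lemma rectangle_inj R n (pos pos' : nat -> nat) k l :
    label_order n pos -> label_order n pos' ->
    (0 < k <= n)%N -> (0 < l <= n)%N -> rectangle R n pos k = rectangle R n pos' l ->
  k = l /\ [/\ left_of pos k = left_of pos' k, top_of pos k = top_of pos' k,
    right_of n pos k = right_of n pos' k & bottom_of n pos k = bottom_of n pos' k].
Proof.
move=> ho ho' k_in l_in [/eqP + /addrI/oppr_inj/eqP + /eqP + /addrI/oppr_inj/eqP].
rewrite !eqr_nat => /eqP eq_l /eqP eq_t /eqP eq_r /eqP eq_b.
have eq_kl : k = l.
  have := left_top_max ho k_in; have := left_top_max ho' l_in.
  by rewrite eq_l eq_t => ->; nlia.
by subst l.
Qed.

(** * Moves *)

Section SameCorners.
Local Open Scope nat_scope.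
Variable n : nat.
Implicit Types (pos : nat -> nat).

Definition same_corners pos pos' := forall k, 0 < k <= n ->
  [/\ left_of pos k = left_of pos' k, top_of pos k = top_of pos' k,
      right_of n pos k = right_of n pos' k & bottom_of n pos k = bottom_of n pos' k].

Lemma same_corners_trans pos1 pos2 pos3 :
  same_corners pos1 pos2 -> same_corners pos2 pos3 -> same_corners pos1 pos3.
Proof. by move=> eq12 eq23 k k_in; case: (eq12 k k_in) => -> -> -> ->; exact: eq23. Qed.

Lemma same_corners_sym pos1 pos2 : same_corners pos1 pos2 -> same_corners pos2 pos1.
Proof. by move=> eq12 k k_in; case: (eq12 k k_in). Qed.

(** Only the order of [a] and [d] changes, so only the searches upward from [a] and downward from
    [d] are at risk. Each of them meets [e] (read before both) or [f] (read after both) before it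
    reaches the other exchanged label. *)
Lemma same_corners_exchange pos pos' a d e f :
    0 < a -> a < e < d -> a < f < d -> d <= n ->
    (forall c k, 0 < c <= n -> 0 < k <= n -> (c, k) != (a, d) -> (c, k) != (d, a) ->
      (pos c < pos k) = (pos' c < pos' k)) ->
    pos e < pos a -> pos e < pos d -> pos a < pos f -> pos d < pos f ->
  same_corners pos pos'.
Proof.
move=> a_gt0 e_in f_in d_le agree ea ed af df k k_in.
have agree' c : 0 < c <= n -> (c, k) != (a, d) -> (c, k) != (d, a) ->
    (pos k < pos c) = (pos' k < pos' c).
  move=> c_in; rewrite !xpair_eqE ![(c == _) && _]andbC -!xpair_eqE => ? ?.
  exact: agree.
have [eq_ka|ne_ka] := eqVneq k a.
  subst k; rewrite /left_of /top_of /right_of /bottom_of; split.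
  - by apply: eq_pred_nearest => // c c_in; apply: agree; rewrite ?xpair_eqE; lia.
  - by apply: eq_pred_nearest => // c c_in; apply: agree'; rewrite ?xpair_eqE; lia.
  - apply: (@before_next_eq_below _ _ _ _ f) => //; first lia.
    + by rewrite -agree' ?xpair_eqE; lia.
    + by move=> c c_in; apply: agree'; rewrite ?xpair_eqE; lia.
  - apply: (@before_next_eq_below _ _ _ _ e) => //; first lia.
    + by rewrite -agree ?xpair_eqE; lia.
    + by move=> c c_in; apply: agree; rewrite ?xpair_eqE; lia.
have [eq_kd|ne_kd] := eqVneq k d.
  subst k; rewrite /left_of /top_of /right_of /bottom_of; split.
  - apply: (@pred_nearest_eq_above _ _ _ e) => //; first lia.
    + by rewrite -agree ?xpair_eqE; lia.
    + by move=> c c_in; apply: agree; rewrite ?xpair_eqE; lia.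
  - apply: (@pred_nearest_eq_above _ _ _ f) => //; first lia.
    + by rewrite -agree' ?xpair_eqE; lia.
    + by move=> c c_in; apply: agree'; rewrite ?xpair_eqE; lia.
  - by apply: eq_before_next => [|c c_in]; [lia | apply: agree'; rewrite ?xpair_eqE; lia].
  - by apply: eq_before_next => [|c c_in]; [lia | apply: agree; rewrite ?xpair_eqE; lia].
split; [apply: eq_pred_nearest | apply: eq_pred_nearest
       | apply: eq_before_next | apply: eq_before_next].
all: try by case/andP: k_in.
all: move=> c c_in; first [apply: agree | apply: agree']; rewrite ?xpair_eqE; lia.
Qed.

(** The witnesses are the first labels above [a] read before it and after it, which the equal
    corners make common to both orders. As [d] follows [a] in one order and precedes it in the
    other, each search stops at [d] at the latest in one order, and cannot stop at [d] in the
    other. *)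
Lemma same_corners_witness pos pos' a d :
    label_order n pos -> label_order n pos' -> same_corners pos pos' ->
    0 < a -> a < d -> d <= n -> pos a < pos d -> pos' d < pos' a ->
  exists e f, [/\ a < e < d, a < f < d, pos e < pos a /\ pos' e < pos' a
    & pos a < pos f /\ pos' a < pos' f].
Proof.
move=> ho ho' same a_gt0 lt_ad d_le lt_pos lt_pos'.
have a_in : 0 < a <= n by lia.
have [_ _ eq_r eq_b] := same a a_in.
have [le_b Pb _] := bottom_ofP ho a_in; have [le_b' Pb' nb'] := bottom_ofP ho' a_in.
have [le_r Pr nr] := right_ofP ho a_in; have [le_r' Pr' _] := right_ofP ho' a_in.
have lt_bd : bottom_of n pos a < d.
  by rewrite eq_b ltnNge; apply/negP => le_db; have := nb' d ltac:(lia); lia.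
have lt_rd : right_of n pos a < d.
  by rewrite ltnNge; apply/negP => le_dr; have := nr d ltac:(lia); lia.
have eb := Pb ltac:(lia); have eb' := Pb' ltac:(lia).
have fr := Pr ltac:(lia); have fr' := Pr' ltac:(lia).
rewrite -eq_b in eb'; rewrite -eq_r in fr'.
exists (bottom_of n pos a).+1, (right_of n pos a).+1; split=> //.
- by have [eq_d|] := eqVneq (bottom_of n pos a).+1 d; [rewrite eq_d in eb; lia | lia].
- by have [eq_d|] := eqVneq (right_of n pos a).+1 d; [rewrite eq_d in fr'; lia | lia].
Qed.

End SameCorners.

(** * Permutations as reading orders, and exchanges of adjacent entries *)

Section Words.
Variables (n : nat).
Implicit Types (x y z : 'S_n) (a b c i j k l : 'I_n).
Local Open Scope nat_scope.

Definition pos_of x (c : nat) := index c (one_line x).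

Lemma pos_ofE x (v : 'I_n) : pos_of x v.+1 = (x^-1)%g v.
Proof.
have inj_x : injective (fun i => (x i : nat).+1) by move=> i j [] /ord_inj /perm_inj.
rewrite /pos_of /one_line -{1}(permKV x v).
exact: etrans (index_map inj_x _ _) (index_enum_ord _).
Qed.

Lemma one_line_uniq x : uniq (one_line x).
Proof. by rewrite map_inj_uniq ?enum_uniq // => i j [] /ord_inj /perm_inj. Qed.

Lemma size_one_line x : size (one_line x) = n.
Proof. by rewrite size_map size_enum_ord. Qed.

Lemma mem_one_line x (c : nat) : (c \in one_line x) = (0 < c <= n).
Proof.
apply/mapP/idP => [[i _ ->]|c_in]; first by rewrite /= ltn_ord.
have lt_c : c.-1 < n by lia.
by exists ((x^-1)%g (Ordinal lt_c)); rewrite ?mem_enum // permKV /=; lia.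
Qed.

Lemma label_ord (c : nat) : 0 < c <= n -> {v : 'I_n | c = v.+1}.
Proof. by move=> c_in; have lt_c : c.-1 < n by [lia]; exists (Ordinal lt_c) => /=; lia. Qed.

Lemma label_order_pos_of x : label_order n (pos_of x).
Proof.
split=> [c|c d]; first by rewrite -[leqRHS](size_one_line x) index_size.
move=> /label_ord[v ->] /label_ord[w ->]; rewrite !pos_ofE => /ord_inj.
by move/perm_inj ->.
Qed.

Lemma tperm_mulK i j x : (tperm i j * (tperm i j * x))%g = x.
Proof. by rewrite mulgA tperm2 mul1g. Qed.

Lemma tperm_mulV i j x a : ((tperm i j * x)^-1)%g a = tperm i j ((x^-1)%g a).
Proof. by rewrite invMg permM tpermV. Qed.

(** Seen from the lower permutation the two moves are one condition: an ascent with an intermediate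
    value on each side. Which of the two intermediate values is larger decides the pattern. *)
Lemma tB_moveP x y : tB_move x y <-> exists i j k l,
  [/\ k < i, j = i.+1 :> nat, j < l & [/\ x i < x k < x j, x i < x l < x j
    & y = (tperm i j * x)%g]].
Proof.
have values i j k l : k < i -> j = i.+1 :> nat -> j < l -> forall w : 'S_n,
    [/\ (tperm i j * w)%g i = w j, (tperm i j * w)%g j = w i,
        (tperm i j * w)%g k = w k & (tperm i j * w)%g l = w l].
  move=> lt_ki eq_j lt_jl w; rewrite !permM tpermL tpermR !tpermD //;
    by rewrite -(inj_eq val_inj) /=; lia.
split.
- case/orP.
    move=> /existsP[k] /existsP[i] /existsP[j] /existsP[l].
    move=> /and5P[lt_ki /eqP eq_j lt_jl lt_yjl /and3P[lt_ylk lt_yki /eqP ->]].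
    exists i, j, k, l; have [-> -> -> ->] := values i j k l lt_ki eq_j lt_jl y.
    by rewrite tperm_mulK; do !split=> //; lia.
  move=> /existsP[k] /existsP[i] /existsP[j] /existsP[l].
  move=> /and5P[lt_ki /eqP eq_j lt_jl lt_yjk /and3P[lt_ykl lt_yli /eqP ->]].
  exists i, j, k, l; have [-> -> -> ->] := values i j k l lt_ki eq_j lt_jl y.
  by rewrite tperm_mulK; do !split=> //; lia.
- move=> [i [j [k [l [lt_ki eq_j lt_jl [xk xl ->]]]]]].
  have [vi vj vk vl] := values i j k l lt_ki eq_j lt_jl x.
  have ne_kl : x k != x l :> nat.
    by apply/eqP => /ord_inj /perm_inj /(congr1 val) /=; lia.
  apply/orP; have [lt_lk|le_kl] := ltnP (x l) (x k); [left | right].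
    apply/existsP; exists k; apply/existsP; exists i; apply/existsP; exists j.
    apply/existsP; exists l; rewrite vi vj vk vl tperm_mulK eqxx eq_j eqxx.
    by rewrite -eq_j lt_ki lt_jl /=; lia.
  apply/existsP; exists k; apply/existsP; exists i; apply/existsP; exists j.
  apply/existsP; exists l; rewrite vi vj vk vl tperm_mulK eqxx eq_j eqxx.
  by rewrite -eq_j lt_ki lt_jl /=; lia.
Qed.

Lemma tB_move_intro x i j (e f : 'I_n) : j = i.+1 :> nat ->
  x i < e < x j -> x i < f < x j -> (x^-1)%g e < i -> j < (x^-1)%g f ->
  tB_move x (tperm i j * x)%g.
Proof.
move=> eq_j e_in f_in lt_ei lt_jf; apply/tB_moveP.
by exists i, j, ((x^-1)%g e), ((x^-1)%g f); rewrite !permKV.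
Qed.

Lemma before_tperm x i j a b : j = i.+1 :> nat ->
    (a, b) != (x i, x j) -> (a, b) != (x j, x i) ->
  (((tperm i j * x)^-1)%g a < ((tperm i j * x)^-1)%g b) = ((x^-1)%g a < (x^-1)%g b).
Proof.
move=> eq_j; rewrite -[a](permKV x) -[b](permKV x) !tperm_mulV.
move: ((x^-1)%g a) ((x^-1)%g b) => {a b} a b; rewrite !permK.
rewrite !xpair_eqE !(inj_eq perm_inj).
rewrite -!(inj_eq val_inj) /=.
by case: (tpermP i j a) => [->|->|/eqP + /eqP +]; case: (tpermP i j b) => [->|->|/eqP + /eqP +];
  rewrite -?(inj_eq val_inj) /=; lia.
Qed.

Lemma tB_move_same_corners x y : tB_move x y -> same_corners n (pos_of x) (pos_of y).
Proof.
move/tB_moveP => [i [j [k [l [lt_ki eq_j lt_jl [xk xl ->]]]]]].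
apply: (@same_corners_exchange _ _ _ (x i).+1 (x j).+1 (x k).+1 (x l).+1) => //.
- move=> _ _ /label_ord[c ->] /label_ord[d ->]; rewrite !pos_ofE !xpair_eqE !eqSS.
  by rewrite !(inj_eq val_inj) -!xpair_eqE => ? ?; rewrite before_tperm.
all: by rewrite !pos_ofE !permK; lia.
Qed.

(** Otherwise the positions in [y] of the successive entries of [x] would increase, and an
    increasing list of all positions is the identity. *)
Lemma adjacent_disagreement x y : x != y ->
  exists i j, j = i.+1 :> nat /\ (y^-1)%g (x j) < (y^-1)%g (x i).
Proof.
move=> ne_xy; apply/not_existsP => agree; case/negP: ne_xy.
have sorted_agree : sorted ltn [seq ((y^-1)%g (x i) : nat) | i <- enum 'I_n].
  apply/(sortedP 0) => k; rewrite size_map size_enum_ord => lt_k.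
  set i := Ordinal (ltnW lt_k); set j := Ordinal lt_k.
  have nthE (m : 'I_n) :
      nth 0 [seq ((y^-1)%g (x i) : nat) | i <- enum 'I_n] m = (y^-1)%g (x m).
    by rewrite (nth_map m) ?size_enum_ord // nth_ord_enum.
  rewrite (nthE i) (nthE j).
  have nlt : ~ ((y^-1)%g (x j) < (y^-1)%g (x i)).
    by move=> lt; apply: (agree i); exists j.
  have ne_ji : (y^-1)%g (x j) != (y^-1)%g (x i).
    by rewrite !(inj_eq perm_inj) -(inj_eq val_inj) /=; lia.
  by rewrite -(inj_eq val_inj) /= in ne_ji; move/negP: nlt; lia.
have sorted_enum : sorted ltn [seq (i : nat) | i <- enum 'I_n].
  by rewrite val_enum_ord iota_ltn_sorted.
have eq_seq : [seq ((y^-1)%g (x i) : nat) | i <- enum 'I_n] = [seq (i : nat) | i <- enum 'I_n].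
  apply: (irr_sorted_eq ltn_trans ltnn) => // k.
  apply/mapP/mapP => -[i _ ->]; first by exists ((y^-1)%g (x i)); rewrite ?mem_enum.
  by exists ((x^-1)%g (y i)); rewrite ?mem_enum // permKV permK.
apply/eqP/permP => i; move/eq_in_map: eq_seq => /(_ i).
by rewrite mem_enum => /(_ isT)/ord_inj eq_i; rewrite -[in RHS]eq_i permKV.
Qed.

(** The decreasing measure both for [same_corners_theta] and for [weak_leP], which lead [x] to [y]
    by exchanges of adjacent entries. *)
Definition disagreements x y := [set p : 'I_n * 'I_n |
  ((x^-1)%g p.1 < (x^-1)%g p.2) && ((y^-1)%g p.2 < (y^-1)%g p.1)]%SET.

Lemma disagreements_tperm x y i j : j = i.+1 :> nat ->
  (y^-1)%g (x j) < (y^-1)%g (x i) ->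
  #|disagreements (tperm i j * x)%g y| < #|disagreements x y|.
Proof.
move=> eq_j lt_ji; apply/proper_card/properP; split.
  apply/fintype.subsetP => -[a b]; rewrite !inE /= => /andP[lt_ab lt_ba].
  rewrite lt_ba andbT.
  have [[eq_a eq_b]|ne1] := eqVneq (a, b) (x i, x j).
    by rewrite eq_a eq_b !permK; lia.
  have [[eq_a eq_b]|ne2] := eqVneq (a, b) (x j, x i).
    by rewrite eq_a eq_b in lt_ba; lia.
  by rewrite -(before_tperm eq_j ne1 ne2).
exists (x i, x j); rewrite !inE /= ?lt_ji ?tperm_mulV !permK ?tpermL ?tpermR; lia.
Qed.

(* If x and y have the same corners and disagree on an adjacent pair of x, the
   labels that bound the rectangle of the smaller entry of this pair witness
   that exchanging the pair is a move. *)
Lemma same_corners_theta x y : same_corners n (pos_of x) (pos_of y) -> theta_tB x y.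
Proof.
have [m] := ubnP #|disagreements x y|; elim: m x => // m IHm x; rewrite ltnS => le_m same.
have [->|ne_xy] := eqVneq x y; first exact: connect0.
have [i [j [eq_j lt_ji]]] := adjacent_disagreement ne_xy.
set x' := (tperm i j * x)%g.
suff move_x : tB_move x x' || tB_move x' x.
  have theta_x : theta_tB x x' by exact: connect1.
  suff: theta_tB x' y by exact: connect_trans.
  apply: IHm; first by exact: leq_trans (disagreements_tperm eq_j lt_ji) le_m.
  apply: same_corners_trans same; case/orP: move_x => /tB_move_same_corners //.
  exact: same_corners_sym.
have lt_xi := ltn_ord (x i); have lt_xj := ltn_ord (x j).
have ho := label_order_pos_of x; have ho' := label_order_pos_of y.
have [lt_x|le_x] := ltnP (x i) (x j).
- have lt_x' : (x i).+1 < (x j).+1 by [].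
  have [] := same_corners_witness ho ho' same (ltn0Sn _) lt_x' (ltn_ord _).
  + by rewrite !pos_ofE !permK eq_j.
  + by rewrite !pos_ofE.
  move=> e0 [f0 [e_in f_in [e1 _] [f1 _]]].
  have [e eq_e] := @label_ord e0 ltac:(lia); have [f eq_f] := @label_ord f0 ltac:(lia).
  rewrite eq_e eq_f !pos_ofE !permK in e_in f_in e1 f1.
  apply/orP; left; apply: (@tB_move_intro _ _ _ e f) => //.
  (* The witness only places [f] after position [i]; it is not at [j] because it is strictly less
     than [x j]. *)
  have : (x^-1)%g f != j.
    apply/eqP => eq_fj; have := permKV x f; rewrite eq_fj => eq.
    by rewrite -eq in f_in; lia.
  by rewrite -(inj_eq val_inj) /=; lia.
(* Here the pair is a descent of [x], so [x] and [y] exchange roles in the search for witnesses, and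
   the move leads from [x'] up to [x]. *)
- have ne_x : x j != x i :> nat.
    by rewrite (inj_eq val_inj) (inj_eq perm_inj) -(inj_eq val_inj) /=; lia.
  have lt_x' : (x j).+1 < (x i).+1 by lia.
  have [] := same_corners_witness ho' ho (same_corners_sym same) (ltn0Sn _) lt_x' (ltn_ord _).
  + by rewrite !pos_ofE.
  + by rewrite !pos_ofE !permK eq_j.
  move=> e0 [f0 [e_in f_in [_ e1] [_ f1]]].
  have [e eq_e] := @label_ord e0 ltac:(lia); have [f eq_f] := @label_ord f0 ltac:(lia).
  rewrite eq_e eq_f !pos_ofE !permK in e_in f_in e1 f1.
  have ne_e : (x^-1)%g e != i.
    apply/eqP => eq_ei; have := permKV x e; rewrite eq_ei => eq.
    by rewrite -eq in e_in; lia.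
  rewrite -(inj_eq val_inj) /= in ne_e.
  have fixed a : (x^-1)%g a != i -> (x^-1)%g a != j -> (x'^-1)%g a = (x^-1)%g a.
    by move=> ? ?; rewrite tperm_mulV tpermD // eq_sym.
  apply/orP; right; rewrite -[X in tB_move _ X](tperm_mulK i j x).
  apply: (@tB_move_intro _ _ _ e f) => //.
  + by rewrite !permM tpermL tpermR; lia.
  + by rewrite !permM tpermL tpermR; lia.
  + by rewrite fixed -?(inj_eq val_inj) /=; lia.
  + by rewrite fixed -?(inj_eq val_inj) /=; lia.
Qed.

Lemma theta_same_corners x y : theta_tB x y -> same_corners n (pos_of x) (pos_of y).
Proof.
move=> /connectP[p path_p ->]; elim: p x path_p => [|z p IHp] x /=; first by move=> _ k _.
move=> /andP[move_xz /IHp]; apply: same_corners_trans.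
by case/orP: move_xz => /tB_move_same_corners // /same_corners_sym.
Qed.

End Words.

(** * The weak order *)

Section WeakOrderJoin.
Variables (n : nat).
Implicit Types (x y z w : 'S_n) (a b c i j : 'I_n).
Local Open Scope nat_scope.

Definition inversion x : rel 'I_n := fun a b => (a < b) && ((x^-1)%g b < (x^-1)%g a).

Lemma weak_coverP x y : weak_cover x y <->
  exists i j, [/\ j = i.+1 :> nat, x i < x j & y = (tperm i j * x)%g].
Proof.
split=> [/existsP[i /existsP[j /and3P[/eqP ? ? /eqP ?]]]|[i [j [eq_j lt_x ->]]]].
  by exists i, j.
by apply/existsP; exists i; apply/existsP; exists j; rewrite eq_j lt_x !eqxx.
Qed.

Lemma inversion_tperm x i j a b : j = i.+1 :> nat -> x i < x j ->
  inversion (tperm i j * x)%g a b = inversion x a b || ((a, b) == (x i, x j)).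
Proof.
move=> eq_j lt_x; rewrite /inversion.
have [[-> ->]|ne1] := eqVneq (a, b) (x i, x j).
  by rewrite !tperm_mulV !permK tpermL tpermR; lia.
have [[-> ->]|ne2] := eqVneq (a, b) (x j, x i); first by lia.
by rewrite before_tperm ?orbF // xpair_eqE andbC -xpair_eqE.
Qed.

(** For the converse, an adjacent pair of [x] that [y] orders differently must be an ascent of [x],
    since a descent would be an inversion missing from [y]. Exchanging it is a cover, and it adds
    only an inversion of [y]. *)
Lemma weak_leP x y : weak_le x y <-> subrel (inversion x) (inversion y).
Proof.
split.
  move=> /connectP[p path_p ->]; elim: p x path_p => [|z p IHp] x /=; first by move=> _ a b.
  move=> /andP[/weak_coverP[i [j [eq_j lt_x ->]]] /IHp sub] a b inv_ab.
  by apply: sub; rewrite inversion_tperm // inv_ab.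
have [m] := ubnP #|disagreements x y|; elim: m x => // m IHm x; rewrite ltnS => le_m sub.
have [->|ne_xy] := eqVneq x y; first exact: connect0.
have [i [j [eq_j lt_ji]]] := adjacent_disagreement ne_xy.
have lt_x : x i < x j.
  rewrite ltnNge; apply/negP => le_x.
  have ne_x : x j != x i :> nat.
    by rewrite (inj_eq val_inj) (inj_eq perm_inj) -(inj_eq val_inj) /=; lia.
  by have := sub (x j) (x i); rewrite /inversion !permK; lia.
have step : weak_le x (tperm i j * x)%g by apply/connect1/weak_coverP; exists i, j.
suff: weak_le (tperm i j * x)%g y by exact: connect_trans.
apply: IHm; first by exact: leq_trans (disagreements_tperm eq_j lt_ji) le_m.
move=> a b; rewrite inversion_tperm // => /orP[/sub //|/eqP[-> ->]].
by rewrite /inversion lt_x lt_ji.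
Qed.

Lemma weak_le_refl x : weak_le x x.
Proof. exact: connect0. Qed.

Lemma perm_of_order (o : rel 'I_n) : irreflexive o -> transitive o ->
    (forall a b, a != b -> o a b || o b a) ->
  exists z, forall a b, ((z^-1)%g a < (z^-1)%g b) = o a b.
Proof.
move=> o_irr o_trans o_total.
pose rank a := #|[pred c | o c a]|.
have rank_lt a b : o a b -> rank a < rank b.
  move=> o_ab; apply/proper_card/properP; split.
    by apply/fintype.subsetP => c; rewrite !inE => o_ca; apply: o_trans o_ab.
  by exists a; rewrite !inE ?o_irr.
have rank_n a : rank a < n.
  rewrite -[ltnRHS](card_ord n); apply/proper_card/properP; split.
    exact/fintype.subsetP.
  by exists a; rewrite !inE ?o_irr.
have rank_inj : injective (fun a => Ordinal (rank_n a)).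
  move=> a b [eq_rank]; apply/eqP/negPn/negP => /o_total.
  by case/orP => /rank_lt; rewrite eq_rank ltnn.
exists (perm rank_inj)^-1%g => a b; rewrite invgK !permE /=.
have [->|ne_ab] := eqVneq a b; first by rewrite ltnn o_irr.
apply/idP/idP => [lt_ab|]; last exact: rank_lt.
by case/orP: (o_total _ _ ne_ab) => // /rank_lt; lia.
Qed.

(* The inversions of the join of x and y are the transitive closure of those of
   x and of y. *)
Lemma weak_join_exists x y : exists z, is_join x y z.
Proof.
pose r : rel 'I_n := fun a b => inversion x a b || inversion y a b.
pose t : rel 'I_n := fun a b => (a < b) && connect r a b.
have inv_split w a b c : inversion w a c -> a < b -> b < c ->
    inversion w a b || inversion w b c.
  by rewrite /inversion; lia.
have t_r a b : r a b -> t a b.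
  by move=> r_ab; rewrite /t connect1 // andbT; case/orP: r_ab => /andP[].
have t_trans b a c : t a b -> t b c -> t a c.
  move=> /andP[lt_ab ab] /andP[lt_bc bc]; rewrite /t (connect_trans ab bc).
  by rewrite (ltn_trans lt_ab lt_bc).
(* Inversion sets are the relations with both this property and transitivity. Along an increasing
   chain from [a] to [c], the step that passes over [b] is an inversion of [x] or [y] and splits
   there. *)
have t_split a b c : t a c -> a < b -> b < c -> t a b || t b c.
  move=> /andP[_ /connectP[p path_p ->]].
  elim: p a path_p => [|v p IHp] a /=; first by lia.
  move=> /andP[r_av path_p] lt_ab lt_bc.
  have [lt_bv|lt_vb|eq_bv] := ltngtP b v.
  + have : r a b || r b v.
      case/orP: r_av => inv_av; have := inv_split _ a b v inv_av lt_ab lt_bv.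
        by rewrite /r; case/orP => ->; rewrite ?orbT.
      by rewrite /r; case/orP => ->; rewrite ?orbT.
    case/orP => [/t_r -> //|r_bv]; rewrite /t lt_bc /=.
    by apply/orP; right; apply: connect_trans (connect1 r_bv) _; apply/connectP; exists p.
  + case/orP: (IHp v path_p lt_vb lt_bc) => [t_vb|->]; last by rewrite orbT.
    by rewrite (t_trans _ _ _ (t_r _ _ r_av) t_vb).
  + by rewrite (ord_inj eq_bv) t_r.
have t_lt a b : t a b -> a < b by case/andP.
(* The reading order of the join: exactly the pairs in [t] are inverted. Its transitivity rests on
   [t_trans] and [t_split]. *)
pose o : rel 'I_n := fun a b => if a < b then ~~ t a b else t b a.
have [||a b ne_ab|z z_o] := @perm_of_order o.
- by move=> a; rewrite /o ltnn; apply/negP => /t_lt; rewrite ltnn.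
- move=> b a c; rewrite /o.
  case: (ltngtP a b) => [lt_ab|lt_ba|/ord_inj -> /t_lt]; last by rewrite ltnn.
  + case: (ltngtP b c) => [lt_bc|lt_cb|/ord_inj -> _ /t_lt]; last by rewrite ltnn.
      move=> ntab ntbc; rewrite (ltn_trans lt_ab lt_bc); apply/negP => t_ac.
      by have := t_split _ _ _ t_ac lt_ab lt_bc; rewrite (negPf ntab) (negPf ntbc).
    move=> ntab tcb; case: (ltngtP a c) => [lt_ac|lt_ca|/ord_inj eq_ac].
    - by apply: contra ntab => t_ac; apply: t_trans tcb.
    - by have := t_split _ _ _ tcb lt_ca lt_ab; rewrite (negPf ntab) orbF.
    - by rewrite eq_ac tcb in ntab.
  + case: (ltngtP b c) => [lt_bc|lt_cb|/ord_inj -> _ /t_lt]; last by rewrite ltnn.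
      move=> tba ntbc; case: (ltngtP a c) => [lt_ac|lt_ca|/ord_inj eq_ac].
      - by apply: contra ntbc => t_ac; apply: t_trans t_ac.
      - by have := t_split _ _ _ tba lt_bc lt_ca; rewrite (negPf ntbc).
      - by rewrite -eq_ac tba in ntbc.
    move=> tba tcb; rewrite ltnNge ltnW ?(ltn_trans lt_cb) //=.
    exact: t_trans tcb tba.
- rewrite /o; case: (ltngtP a b) ne_ab => [_ _|_ _|/ord_inj ->]; rewrite ?eqxx //.
    by case: (t a b).
  by case: (t b a).
have inv_z a b : inversion z a b = t a b.
  rewrite /inversion z_o /o; case: (ltngtP a b) => //=.
    by rewrite /t => ?; lia.
  by rewrite /t => ->; rewrite ltnn.
exists z; split.
- by apply/weak_leP => a b inv_ab; rewrite inv_z t_r // /r inv_ab.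
- by apply/weak_leP => a b inv_ab; rewrite inv_z t_r // /r inv_ab orbT.
- move=> w /weak_leP le_xw /weak_leP le_yw; apply/weak_leP => a b; rewrite inv_z.
  move=> /andP[lt_ab /connectP[p path_p eq_b]].
  elim: p a path_p eq_b lt_ab => [|v p IHp] a /=; first by move=> _ ->; rewrite ltnn.
  move=> /andP[r_av path_p] eq_b lt_ab.
  have inv_av : inversion w a v by case/orP: r_av => [/le_xw|/le_yw].
  have [lt_vb|le_bv] := ltnP v b.
    have := IHp v path_p eq_b lt_vb; move: inv_av; rewrite /inversion; lia.
  (* Steps of [r] increase, so a chain from [v] to [b] with [b <= v] is empty and [v] equals [b]. *)
  have : connect r v b by apply/connectP; exists p.
  case/connectP => -[|u q] /=; first by move=> _ ->.
  move=> path_q eq_b'; suff: v < b by lia.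
  rewrite eq_b'; elim: q u v {le_bv path_p eq_b eq_b' inv_av r_av} path_q => [|u' q IHq] u v /=.
    by rewrite andbT => /t_r/t_lt.
  by move=> /andP[/t_r/t_lt lt_vu /IHq /(ltn_trans lt_vu)].
Qed.

Lemma is_join_le x z : weak_le x z -> is_join x z z.
Proof. by move=> le_xz; split=> //; exact: weak_le_refl. Qed.

Lemma is_meet_le x z : weak_le x z -> is_meet x z x.
Proof. by move=> le_xz; split=> //; exact: weak_le_refl. Qed.

Lemma tB_move_cover x y : tB_move x y -> weak_cover x y.
Proof.
move=> /tB_moveP[i [j [k [l [lt_ki eq_j lt_jl [xk xl ->]]]]]].
by apply/weak_coverP; exists i, j; split=> //; lia.
Qed.

(* Congruent elements are congruent to their join, hence to every element of the
   two intervals below it, so that they are linked by congruent covers. *)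
Lemma tB_congruence_theta (Theta : rel 'S_n) : tB_congruence Theta ->
  forall x y, Theta x y <-> theta_tB x y.
Proof.
move=> [[Theta_eq Theta_join Theta_meet] Theta_cover].
have T_refl x : Theta x x by case: (Theta_eq x x x).
have T_sym x y : Theta x y -> Theta y x.
  by move=> xy; have [_ /(_ xy)] := Theta_eq x y x; rewrite T_refl.
have T_trans y x z : Theta x y -> Theta y z -> Theta x z.
  by move=> xy yz; have [_ /(_ xy) ->] := Theta_eq x y z.
have theta_sym x y : theta_tB x y -> theta_tB y x.
  by move=> /theta_same_corners/same_corners_sym/same_corners_theta.
have theta_le x z : weak_le x z -> Theta x z -> theta_tB x z.
  move=> /connectP[p path_p eq_z]; elim: p x path_p eq_z => [|w p IHp] x /=.
    by move=> _ -> _; exact: connect0.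
  move=> /andP[cov_xw path_p] eq_z xz.
  have le_wz : weak_le w z by apply/connectP; exists p.
  have xw : Theta x w.
    (* The congruent elements [x] and [z] are both met with [w], which lies between them; this
       yields [x] and [w]. *)
    have meet_xw : is_meet x w x by apply: is_meet_le; exact: connect1.
    have meet_zw : is_meet z w w by split=> //; exact: weak_le_refl.
    exact: Theta_meet xz (T_refl w) meet_xw meet_zw.
  have step : theta_tB x w by apply: connect1; rewrite -Theta_cover // xw.
  suff: theta_tB w z by exact: connect_trans.
  by apply: IHp => //; apply: T_trans xz; exact: T_sym.
move=> x y; split.
  move=> xy; have [z join_z] := weak_join_exists x y.
  have [le_xz le_yz _] := join_z.
  (* Joining the congruent [x] and [y] with [x] yields [x] and [z]. *)
  have xz : Theta x z.
    by apply: (Theta_join x x x y) join_z => //; apply: is_join_le; exact: weak_le_refl.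
  have yz : Theta y z by apply: T_trans xz; exact: T_sym.
  have := theta_le _ _ le_xz xz; have /theta_sym := theta_le _ _ le_yz yz => zy xz'.
  exact: connect_trans zy.
move=> /connectP[p path_p ->]; elim: p x path_p => [|z p IHp] x /=; first by [].
move=> /andP[move_xz /IHp]; apply: T_trans; case/orP: move_xz => move_xz.
  by rewrite Theta_cover ?move_xz //; exact: tB_move_cover.
by apply: T_sym; rewrite Theta_cover ?move_xz //; exact: tB_move_cover.
Qed.

End WeakOrderJoin.

(** * The fibers of the drawing map *)

Section Rho.
Local Open Scope classical_set_scope.
Local Open Scope ring_scope.
Variables (R : realType) (n : nat).
Implicit Types x y : 'S_n.

Lemma drawP_one_line x :
  drawn n (draw R n (one_line x)) = staircase n (fun c => c \in one_line x) /\
  draw R n (one_line x) = [seq rectangle R n (pos_of x) k | k <- one_line x].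
Proof.
have s_in : {in one_line x, forall k, 0 < k <= n}%N by move=> k; rewrite mem_one_line.
have [-> ->] := drawP R (one_line_uniq x) s_in; split=> //.
apply/eq_in_map => k /s_in k_in.
exact: (cell_rectangle R (label_order_pos_of x) k_in).
Qed.

Lemma rho_rectangles x : @rho R n x = rectangles n (pos_of x).
Proof.
rewrite /rho -/(draw R n (one_line x)) (drawP_one_line x).2.
apply/seteqP; split=> r /=.
  by move=> /mapP[k]; rewrite mem_one_line => k_in ->; exists k.
by move=> [k k_in <-]; apply/mapP; exists k; rewrite ?mem_one_line.
Qed.

Lemma rho_dRec x : (0 < n)%N -> dRec n (@rho R n x).
Proof.
move=> n_gt0; rewrite rho_rectangles.
apply: (rectangles_dRec (label_order_pos_of x) n_gt0) => q q1 q2.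
have : staircase n (fun c => c \in one_line x) q.
  (* With all labels read there is a single run, from 1 to [n], and its corner is the top-right
     corner of the square. *)
  split; [lra|lra|constructor 3]; exists 0%N, n; split; [nlia| |lra|lra].
  by move=> c; rewrite mem_one_line.
rewrite -(drawP_one_line x).1 (drawP_one_line x).2.
case=> [[[/= q1' _]|[/= _ q2']]|[r /mapP[k]]]; [lra|lra|].
by rewrite mem_one_line => k_in -> kq; exists k.
Qed.

Lemma rho_eq_same_corners x y : @rho R n x = @rho R n y <-> same_corners n (pos_of x) (pos_of y).
Proof.
rewrite !rho_rectangles; split=> [eq_xy k k_in|same].
  have : @rectangles R n (pos_of x) (rectangle R n (pos_of x) k) by exists k.
  rewrite eq_xy => -[l /= l_in].
  move=> /(rectangle_inj (label_order_pos_of y) (label_order_pos_of x) l_in k_in)[eq_lk].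
  by rewrite eq_lk => -[-> -> -> ->].
have eq_r k : (0 < k <= n)%N -> rectangle R n (pos_of x) k = rectangle R n (pos_of y) k.
  by move=> /same[eq_l eq_t eq_r eq_b]; rewrite /rectangle eq_l eq_t eq_r eq_b.
by apply/seteqP; split=> _ [k /= k_in <-]; exists k => //; rewrite eq_r.
Qed.

Lemma rho_eq_theta x y : @rho R n x = @rho R n y <-> theta_tB x y.
Proof.
split=> [/rho_eq_same_corners/same_corners_theta //|].
by move=> /theta_same_corners/rho_eq_same_corners.
Qed.

Lemma rho_fibers_classes (Theta : rel 'S_n) : (0 < n)%N ->
  (forall x y, Theta x y <-> @rho R n x = @rho R n y) ->
  forall C : set 'S_n, is_rho_fiber R C <-> is_class Theta C.
Proof.
move=> n_gt0 ThetaE C; split.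
- move=> [F [_ -> [x /= eq_F]]]; exists x; rewrite -eq_F.
  by apply/seteqP; split=> y /= => [eq_xy|/ThetaE //]; apply/ThetaE.
- move=> [x ->]; exists (@rho R n x); split; first exact: rho_dRec.
    by apply/seteqP; split=> y /= => [/ThetaE //|eq_xy]; apply/ThetaE.
  by exists x; apply/ThetaE.
Qed.

End Rho.

Theorem proposition6p3 (R : realType) (n : nat) (n_ge1 : (1 <= n)%N) :
  (forall C : set 'S_n, is_rho_fiber R C <-> is_class (@theta_tB n) C) /\
  (forall Theta : rel 'S_n, tB_congruence Theta ->
     forall C : set 'S_n, is_rho_fiber R C <-> is_class Theta C).
Proof.
split=> [|Theta /tB_congruence_theta ThetaE]; apply: rho_fibers_classes => // x y.
  exact: iff_sym (rho_eq_theta R x y).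
exact: iff_trans (ThetaE x y) (iff_sym (rho_eq_theta R x y)).
Qed.
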